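(* In the Bayesian $k$-armed bandit problem described in the context, suppose the prior $\Gamma$ is $1$-regular with constants $0<c_0<C_0$ and every $P_\mu$ is $1$-subgaussian, and the Greedy algorithm is executed. Then for $k\ge(54e\log T)/c_0$, $$BR_{T,k}(\mathrm{Greedy})\le1+3T\Bigl[\frac{2e\log T}{kc_0}\Bigr]^{1/3}+\frac{C_0k}{C_1}\bigl(15+\log(kc_0/2e)-\log\log T\bigr),$$ where $C_1=(1-e^{-1})/2$. Furthermore, the Bayesian regret of SS-Greedy executed with $m=\Theta(T^{3/4})$ is $\tilde O(T^{3/4})$.
   Context: Bayesian $k$-armed bandit: horizon $T$, arms $[k]$, family $\{P_\mu:\mu\in[0,1]\}$ with $P_\mu$ of mean $\mu$; prior $\Gamma$ on $[0,1]$ with density; means i.i.d. $\sim\Gamma$; pulling arm $i$ at time $t$ gives $Y_{it}\sim P_{\mu_i}$ independently, only the pulled reward observed. $R_T(\pi\mid\bm\mu)=T\max_i\mu_i-\sum_t\mathbb{E}[\mu_{a_t}\mid\pi]$, $BR_{T,k}(\pi)=\mathbb{E}[R_T(\pi\mid\bm\mu)]$. $1$-regular: $c_0\epsilon\le\mathbb{P}_\Gamma(\mu>1-\epsilon)\le\mathbb{P}_\Gamma(\mu\ge1-\epsilon)\le C_0\epsilon$ for $\epsilon\in(0,1]$. $1$-subgaussian: $\mathbb{E}[e^{s(Z-\mu)}]\le e^{s^2/2}$ for $Z\sim P_\mu$. Greedy: pull each arm once, then always the arm with largest empirical mean. SS-Greedy($m$): run Greedy on $m$ arms drawn uniformly without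 replacement from $[k]$. $\tilde O$ hides polylog factors and constants. *)

(* Defs.v *)
From HB Require Import structures.
From mathcomp Require Import all_boot all_order all_algebra.
From mathcomp Require Import all_classical all_reals all_analysis.
From mathcomp Require Import measurable_realfun.
Set Implicit Arguments. Unset Strict Implicit. Unset Printing Implicit Defensive.
Import Order.TTheory GRing.Theory Num.Theory.
Import numFieldNormedType.Exports.
Local Open Scope classical_set_scope.
Local Open Scope ring_scope.

Section BanditDefs.
Context {R : realType}.

Fixpoint argmax_first (f : nat -> R) (n : nat) : nat :=
  match n with
  | 0 => 0%N
  | n'.+1 => let j := argmax_first f n' in if f j < f n' then n' else j
  end.

(** Empirical mean of arm i given the history h (h`_s = arm pulled at time s),
    where arm i pulled at time s yields reward y i s. *)
Definition emp_mean (y : nat -> nat -> R) (h : seq nat) (i : nat) : R :=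
  (\sum_(s < size h | nth 0%N h s == i) y i s) / (count (pred1 i) h)%:R.

Fixpoint greedy_hist (k : nat) (y : nat -> nat -> R) (t : nat) : seq nat :=
  match t with
  | 0 => [::]
  | t'.+1 => let h := greedy_hist k y t' in
     rcons h (if (t' < k)%N then t' else argmax_first (emp_mean y h) k)
  end.

Definition greedy_action (k : nat) (y : nat -> nat -> R) (t : nat) : nat :=
  nth 0%N (greedy_hist k y t.+1) t.

Definition max_mean (k : nat) (mu : nat -> R) : R := \big[Num.max/0]_(i < k) mu i.

Definition greedy_regret (k T : nat) (mu : nat -> R) (y : nat -> nat -> R) : R :=
  T%:R * max_mean k mu - \sum_(t < T) mu (greedy_action k y t).

Definition ssgreedy_regret (k m T : nat) (mu : nat -> R) (y : nat -> nat -> R)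
    (sel : nat -> nat) : R :=
  T%:R * max_mean k mu
  - \sum_(t < T) mu (sel (greedy_action m (fun j s => y (sel j) s) t)).

Definition prior_on_01_with_density (Gam : probability R R) : Prop :=
  Gam [set x | 0 <= x <= 1] = 1%E /\
  exists f : R -> R, measurable_fun setT f /\ (forall x, 0 <= f x) /\
    forall A, measurable A -> Gam A = (\int[lebesgue_measure]_(x in A) (f x)%:E)%E.

Definition one_regular (Gam : probability R R) (c0 C0 : R) : Prop :=
  forall e : R, 0 < e <= 1 ->
    ((c0 * e)%:E <= Gam [set x | (1 - e < x)%R])%E /\
    (Gam [set x | (1 - e < x)%R] <= Gam [set x | (1 - e <= x)%R])%E /\
    (Gam [set x | (1 - e <= x)%R] <= (C0 * e)%:E)%E.

Definition reward_family (Pk : R -> probability R R) : Prop :=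
  (forall B, measurable B -> measurable_fun [set: R] (fun m => Pk m B)) /\
  (forall m, 0 <= m <= 1 -> (\int[Pk m]_x x%:E)%E = m%:E) /\
  (forall m s, 0 <= m <= 1 ->
     (\int[Pk m]_x (expR (s * (x - m)))%:E <= (expR (s ^+ 2 / 2))%:E)%E).

(** The joint law of the Bayesian bandit on a probability space:
    mu_i iid ~ Gam, and given mu, the rewards Y i t (arm i, time t < T)
    are independent with law P_{mu_i}. Stated on rectangles:
    P(/\_i {mu_i in A_i, Y_{i t} in B_{i t} for t < T})
      = prod_i int_{A_i} prod_{t<T} P_x(B_{i t}) Gam(dx). *)
Definition rect_event d (Om : measurableType d) (k T : nat)
    (mu : nat -> Om -> R) (Y : nat -> nat -> Om -> R)
    (A : nat -> set R) (B : nat -> nat -> set R) : set Om :=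
  \big[setI/setT]_(i < k)
     (mu i @^-1` A i `&` \big[setI/setT]_(t < T) (Y i t @^-1` B i t)).

Definition rect_prob (Gam : probability R R) (Pk : R -> probability R R)
    (k T : nat) (A : nat -> set R) (B : nat -> nat -> set R) : \bar R :=
  (\prod_(i < k) \int[Gam]_(x in A i) \prod_(t < T) Pk x (B i t))%E.

Definition bandit_law d (Om : measurableType d) (P : probability Om R)
    (Gam : probability R R) (Pk : R -> probability R R) (k T : nat)
    (mu : nat -> Om -> R) (Y : nat -> nat -> Om -> R) : Prop :=
  (forall i, measurable_fun setT (mu i)) /\
  (forall i t, measurable_fun setT (Y i t)) /\
  forall (A : nat -> set R) (B : nat -> nat -> set R),
    (forall i, measurable (A i)) -> (forall i t, measurable (B i t)) ->
    P (rect_event k T mu Y A B) = rect_prob Gam Pk k T A B.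

(** Same, plus an independent selection sel 0, ..., sel (m-1) of m arms drawn
    uniformly without replacement from [0,k) (uniform over injections). *)
Definition ss_bandit_law d (Om : measurableType d) (P : probability Om R)
    (Gam : probability R R) (Pk : R -> probability R R) (k m T : nat)
    (mu : nat -> Om -> R) (Y : nat -> nat -> Om -> R)
    (sel : nat -> Om -> nat) : Prop :=
  bandit_law P Gam Pk k T mu Y /\
  (forall j n, measurable [set w | sel j w = n]) /\
  forall (A : nat -> set R) (B : nat -> nat -> set R) (s : nat -> nat),
    (forall i, measurable (A i)) -> (forall i t, measurable (B i t)) ->
    (forall j, (j < m)%N -> (s j < k)%N) ->
    (forall j j', (j < m)%N -> (j' < m)%N -> s j = s j' -> j = j') ->
    P (rect_event k T mu Y A B `&`
       \big[setI/setT]_(j < m) [set w | sel j w = s j])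
    = (rect_prob Gam Pk k T A B * ((k - m)`!%:R / k`!%:R)%:E)%E.

End BanditDefs.

(* Main.v *)
Require Import Defs.
From HB Require Import structures.
From mathcomp Require Import all_boot all_order all_algebra.
From mathcomp Require Import all_classical all_reals all_analysis.
From mathcomp Require Import measurable_realfun giry ring lra.
Import Order.TTheory GRing.Theory Num.Theory.
Import numFieldNormedType.Exports.
Local Open Scope classical_set_scope.
Local Open Scope ring_scope.

(** Put theta = 1 - 2 dl with dl ^ 3 = 2 e log T / (k c0), and let S_i, n_i be
the total reward and the number of pulls of arm i before time t. Rewards are
indexed by time and the pull times are adaptive, so the usual coupling with
independent reward stacks is not available; all probabilistic estimates are
one-step supermartingale inequalities instead.

If mu_i >= 1 - dl, then min(1, exp(-2 dl (S_i - n_i theta))) is a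
supermartingale in the pulls of arm i, and it is 1 whenever the empirical mean
of arm i is at most theta. One time step changes only the pulled arm, so the
product over all arms is again a supermartingale; it bounds the probability that
every empirical mean is below theta, and its initial expectation factorizes over
the arms and is at most 1 / T.

If D = theta - mu_i > dl, then
exp(D (S_i - n_i mu_i) - n_i D^2) / (1 - exp(-D^2 / 2)) decreases in
expectation by at least 1 at each pull made while the empirical mean is at least
theta. So such pulls number at most 1 / (1 - exp(-D^2 / 2)) in expectation, and
integrating this against 1-regularity over a dyadic grid yields the last term of
the bound.

For SS-Greedy, the subsampled arms form a Bayesian bandit with m arms. *)

Set Implicit Arguments.
Unset Strict Implicit.
Unset Printing Implicit Defensive.

(** The exponent 3 in [dl] comes from a balance. A good arm has prior probability at least c0 dl,
    and its potential starts at exp (- dl^2 / 2) instead of 1, a saving of order dl^2. Each of the k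
    independent arms thus contributes a factor of at most 1 - c0 dl^3 / (2 e) to the initial
    expectation, and [dl] is chosen so that the product is at most 1 / T. Summed over T rounds this
    is the leading 1 of the bound. The term 3 T dl pays for the arms within 3 dl of the largest
    conceivable mean 1: 2 dl down to the threshold, and one more dl to keep D away from 0, where the
    bound on the number of pulls blows up.

    The formal obstacle is that the joint law is prescribed only on rectangles. Conditioning a
    reward on an adaptive past is rebuilt as an integral identity over the sigma-algebra of the
    means and past rewards. The arm pulled next is measurable in it, so each step can be split by
    arm and treated as if the arm were fixed. *)

(** * Integration against a measure with bounded density *)

Section density.
Context d (X : measurableType d) (R : realType).
Variables (m : probability X R) (g : X -> R).
Hypothesis g0 : forall x, 0 <= g x.
Hypothesis g1 : forall x, g x <= 1.
Hypothesis mg : measurable_fun setT g.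

(** Binding [m] with the kernel x -> g x * dirac x produces the measure with density [g], so
    integrals against it follow from the Giry monad laws. The bound g <= 1 makes each value a
    subprobability. *)
Definition scaled_dirac (x : X) : set X -> \bar R := mscale (NngNum (g0 x)) \d_x.

HB.instance Definition _ x := Measure.on (scaled_dirac x).

Let scaled_dirac_le1 x : (scaled_dirac x setT <= 1)%E.
Proof. by rewrite /scaled_dirac /= /mscale /= diracT mule1 lee_fin. Qed.

HB.instance Definition _ x :=
  Measure_isSubProbability.Build _ _ _ (scaled_dirac x) (scaled_dirac_le1 x).

Let gsdirac (x : X) : giry X R := scaled_dirac x.

Let mgsdirac : measurable_fun setT gsdirac.
Proof.
apply: measurable_giry_codensity => // B mB.
rewrite (_ : (fun _ => _) = (fun x => (g x * \1_B x)%:E)); last first.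
  by apply/funext => x.
apply/measurable_EFinP; apply: measurable_funM => //.
Qed.

Lemma ge0_integral_density (nu : {measure set X -> \bar R}) (C : R) (h : X -> \bar R) :
  0 <= C ->
  (forall A, measurable A -> nu A = (C%:E * \int[m]_(x in A) (g x)%:E)%E) ->
  measurable_fun setT h -> (forall x, 0 <= h x)%E ->
  (\int[nu]_x h x = C%:E * \int[m]_x ((g x)%:E * h x))%E.
Proof.
move=> C0 nuE mh h0.
have intE (f : X -> \bar R) : measurable_fun setT f -> (forall x, 0 <= f x)%E ->
    (\int[giry_bind (m : giry X R) mgsdirac]_x f x = \int[m]_x ((g x)%:E * f x))%E.
  move=> mf f0; rewrite -[LHS]/(giry_int _ _) giry_int_bind//.
  apply: eq_integral => x _.
  rewrite /giry_int /= ge0_integral_mscale//=.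
  by rewrite integral_dirac// diracT mul1e.
transitivity (\int[mscale (NngNum C0) (giry_bind (m : giry X R) mgsdirac)]_x h x)%E; last first.
  by rewrite ge0_integral_mscale// intE.
apply: eq_measure_integral => A mA _.
rewrite nuE// /mscale /=; congr (_ * _)%E.
rewrite -[in RHS](setIT A) -integral_indic//.
rewrite intE//; last exact/measurable_EFinP.
rewrite integral_mkcond; apply: eq_integral => x _.
by rewrite epatch_indic muleC.
Qed.

End density.

(** * Conditioning on the means and on the past rewards *)

Section filtration.
Context (R : realType) (Gam : probability R R) (Pk : R -> probability R R).
Context (k T : nat) d (Om : measurableType d) (P : probability Om R).
Context (mu : nat -> Om -> R) (Y : nat -> nat -> Om -> R).
Hypothesis mPk : forall B, measurable B -> measurable_fun setT (fun m => Pk m B).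
Hypothesis law : bandit_law P Gam Pk k T mu Y.

Lemma rect_eventP (A : nat -> set R) (B : nat -> nat -> set R) w :
  rect_event k T mu Y A B w <->
  forall i, (i < k)%N -> A i (mu i w) /\ forall s, (s < T)%N -> B i s (Y i s w).
Proof.
pose F i := mu i @^-1` A i `&` \big[setI/setT]_(s < T) (Y i s @^-1` B i s).
rewrite -[rect_event _ _ _ _ _ _]/(\big[setI/setT]_(i < k) F i) -bigcap_mkord.
have FE i : F i w <-> A i (mu i w) /\ forall s, (s < T)%N -> B i s (Y i s w).
  by rewrite /F -(bigcap_mkord T (fun s => Y i s @^-1` B i s)).
by split=> h i ik; apply/FE; exact: h.
Qed.

Lemma measurable_rect_event (A : nat -> set R) (B : nat -> nat -> set R) :
  (forall i, measurable (A i)) -> (forall i s, measurable (B i s)) ->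
  measurable (rect_event k T mu Y A B).
Proof.
move=> mA mB; have [mmu [mY _]] := law.
apply: bigsetI_measurable => i _; apply: measurableI.
  by rewrite -[X in measurable X]setTI; exact: mmu.
apply: bigsetI_measurable => s _.
by rewrite -[X in measurable X]setTI; exact: mY.
Qed.

(* Generates the sigma-algebra of the means and of all rewards, pulled or not,
   before time t. *)
Definition past (t : nat) : set (set Om) :=
  [set E | exists A B, [/\ forall i, measurable (A i),
     forall i s, measurable (B i s), forall i s, (t <= s)%N -> B i s = setT &
     E = rect_event k T mu Y A B]].

Lemma past_setT t : past t setT.
Proof.
exists (fun=> setT), (fun _ _ => setT); split => //.
by apply/esym/seteqP; split => // w _; apply/rect_eventP.
Qed.

Lemma past_setI t : setI_closed (past t).
Proof.
move=> _ _ [A [B [mA mB tB ->]]] [A' [B' [mA' mB' tB' ->]]].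
exists (fun i => A i `&` A' i), (fun i s => B i s `&` B' i s); split.
- by move=> i; exact: measurableI.
- by move=> i s; exact: measurableI.
- by move=> i s ts; rewrite tB// tB'// setTI.
- apply/seteqP; split => w.
    move=> [/rect_eventP h /rect_eventP h']; apply/rect_eventP => i ik.
    have [? hB] := h i ik; have [? hB'] := h' i ik.
    by split => // s sT; split; [exact: hB|exact: hB'].
  move=> /rect_eventP h; split; apply/rect_eventP => i ik;
    have [[? ?] hB] := h i ik; split => // s sT; by have [] := hB _ sT.
Qed.

Lemma past_measurable t : past t `<=` measurable.
Proof. by move=> _ [A [B [mA mB _ ->]]]; exact: measurable_rect_event. Qed.

Lemma past_mono t t' : (t <= t')%N -> past t `<=` past t'.
Proof.
move=> tt' E [A [B [mA mB tB ->]]]; exists A, B; split => // i s t's.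
by apply: tB; exact: leq_trans t's.
Qed.

Notation Fs t := (g_sigma_algebraType (past t)).

Lemma measurable_past_sub t (E : set Om) : measurable (E : set (Fs t)) -> measurable E.
Proof.
move=> mE; suff: <<s past t >> `<=` @measurable _ Om by apply.
apply: smallest_sub; [exact: sigma_algebra_measurable|exact: past_measurable].
Qed.

Lemma measurable_past_le t t' (E : set Om) : (t <= t')%N ->
  measurable (E : set (Fs t)) -> measurable (E : set (Fs t')).
Proof.
move=> tt'; suff: <<s past t >> `<=` <<s past t' >> by apply.
apply: smallest_sub; first exact: smallest_sigma_algebra.
exact: subset_trans (past_mono tt') (@sub_gen_smallest _ _ _).
Qed.

Lemma measurable_past_fun_sub t d' (U : measurableType d') (f : Om -> U) :
  measurable_fun (setT : set (Fs t)) f -> measurable_fun setT f.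
Proof. by move=> mf _ B mB; apply: (@measurable_past_sub t); exact: mf. Qed.

Lemma measurable_past_fun_le t t' d' (U : measurableType d') (f : Om -> U) :
  (t <= t')%N ->
  measurable_fun (setT : set (Fs t)) f -> measurable_fun (setT : set (Fs t')) f.
Proof.
by move=> tt' mf _ B mB; apply: (@measurable_past_le t t') => //; exact: mf.
Qed.

Lemma measurable_past_mu t i : (i < k)%N ->
  measurable_fun (setT : set (Fs t)) (mu i).
Proof.
move=> ik _ B mB; apply: sub_sigma_algebra; rewrite setTI.
exists (fun j => if j == i then B else setT), (fun _ _ => setT); split => //.
  by move=> j; case: ifP.
apply/seteqP; split => w /=.
  by move=> Bw; apply/rect_eventP => j jk; split => //; case: eqP => [->|].
by move=> /rect_eventP/(_ i ik)[]; rewrite eqxx.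
Qed.

Lemma measurable_past_Y t i s : (i < k)%N -> (s < t)%N -> (s < T)%N ->
  measurable_fun (setT : set (Fs t)) (Y i s).
Proof.
move=> ik st sT _ B mB; apply: sub_sigma_algebra; rewrite setTI.
exists (fun=> setT), (fun j r => if (j == i) && (r == s) then B else setT); split => //.
- by move=> j r; case: ifP.
- by move=> j r tr; case: andP => // -[_ /eqP rs]; rewrite rs leqNgt st in tr.
apply/seteqP; split => w /=.
  move=> Bw; apply/rect_eventP => j jk; split => // r rT.
  by case: andP => // -[/eqP -> /eqP ->].
by move=> /rect_eventP/(_ i ik)[_ /(_ s sT)]; rewrite !eqxx.
Qed.

End filtration.

(** * A fresh reward on a rectangle of the past *)

Section one_step.
Context (R : realType) (Gam : probability R R) (Pk : R -> probability R R).
Context (k T : nat) d (Om : measurableType d) (P : probability Om R).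
Context (mu : nat -> Om -> R) (Y : nat -> nat -> Om -> R).
Hypothesis mPk : forall B, measurable B -> measurable_fun setT (fun m => Pk m B).
Hypothesis law : bandit_law P Gam Pk k T mu Y.

Local Notation rect := (rect_event k T mu Y).

(** Likelihood of one arm: the conditional probability, given mean [x], that its rewards fall in the
    prescribed sets. *)
Let lik (B : nat -> set R) (x : R) : R := \prod_(s < T) fine (Pk x (B s)).

Let lik_ge0 B x : 0 <= lik B x.
Proof. by apply: prodr_ge0 => s _; exact: fine_ge0. Qed.

Let Pk_fin (x : R) (B : set R) : measurable B -> Pk x B \is a fin_num.
Proof. by move=> mB; exact: fin_num_measure. Qed.

Let lik_le1 B x : (forall s, measurable (B s)) -> lik B x <= 1.
Proof.
move=> mB; apply: prodr_ile1 => s _; rewrite fine_ge0//=.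
by rewrite -lee_fin fineK ?Pk_fin// probability_le1.
Qed.

Let measurable_Pk (B : set R) : measurable B ->
  measurable_fun setT (fun x => fine (Pk x B)).
Proof. by move=> mB; apply: measurableT_comp => //; exact: mPk. Qed.

Let measurable_lik B : (forall s, measurable (B s)) -> measurable_fun setT (lik B).
Proof. by move=> mB; apply: measurable_prod => s _; exact: measurable_Pk. Qed.

Let likE B x : (forall s : nat, measurable (B s)) ->
  (\prod_(s < T) Pk x (B s) = (lik B x)%:E)%E.
Proof.
by move=> mB; rewrite /lik -prodEFin; apply: eq_bigr => s _; rewrite fineK ?Pk_fin.
Qed.

Let rect_prob_bigD1 a A B : (a < k)%N -> (forall i s, measurable (B i s)) ->
  rect_prob Gam Pk k T A B =
  ((\prod_(i < k | i != a :> nat) \int[Gam]_(x in A i) (lik (B i) x)%:E) *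
    \int[Gam]_(x in A a) (lik (B a) x)%:E)%E.
Proof.
move=> ak mB; rewrite /rect_prob (bigD1 (Ordinal ak))//= muleC; congr (_ * _)%E.
  by apply: eq_bigr => i _; apply: eq_integral => x _; rewrite likE.
by apply: eq_integral => x _; rewrite likE.
Qed.

(** Both sides factor over the arms and differ only in the factor of arm [a]. Since [B a t] is the
    whole line, requiring the reward at time [t] to lie in [B'] just multiplies the likelihood of
    that arm by [Pk x B']. *)
Lemma prob_rect_reward a t A B B' : (a < k)%N -> (t < T)%N ->
  (forall i, measurable (A i)) -> (forall i s, measurable (B i s)) ->
  B a t = setT -> measurable B' ->
  P (rect A B `&` Y a t @^-1` B') = (\int[P]_(w in rect A B) Pk (mu a w) B')%E.
Proof.
move=> ak tT mA mB Bat mB'; have [mmu [mY lawE]] := law.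
pose A1 (A' : set R) i := if i == a then A a `&` A' else A i.
pose B1 i s := if (i == a) && (s == t) then B' else B i s.
(* The common contribution of all arms other than [a]; it is finite because each factor lies in
   [0, 1]. *)
pose Cm := fine (\prod_(i < k | i != a :> nat) \int[Gam]_(x in A i) (lik (B i) x)%:E)%E.
have int01 i : (0 <= \int[Gam]_(x in A i) (lik (B i) x)%:E <= 1)%E.
  apply/andP; split; first by apply: integral_ge0 => x _; rewrite lee_fin.
  apply: (@le_trans _ _ (\int[Gam]_(x in A i) (cst 1%E x))%E).
    apply: ge0_le_integral => //.
    - by move=> x _; rewrite lee_fin.
    - by apply/measurable_EFinP; apply: measurable_funTS; exact: measurable_lik.
    - by move=> x _; rewrite lee_fin lik_le1.
  by rewrite integral_cst// mul1e probability_le1.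
have CE : (\prod_(i < k | i != a :> nat) \int[Gam]_(x in A i) (lik (B i) x)%:E)%E = Cm%:E.
  rewrite /Cm fineK//; elim/big_ind: _ => //.
    by move=> x y; exact: fin_numM.
  move=> i _; have /andP[i0 i1] := int01 i.
  by rewrite ge0_fin_numE// (le_lt_trans i1)// ltry.
have C0 : 0 <= Cm.
  rewrite -lee_fin -CE; elim/big_ind: _ => //; first by move=> *; exact: mule_ge0.
  by move=> i _; have /andP[] := int01 i.
have mB1 i s : measurable (B1 i s) by rewrite /B1; case: ifP.
have mA1 A' : measurable A' -> forall i, measurable (A1 A' i).
  by move=> mA' i; rewrite /A1; case: ifP => // _; exact: measurableI.
have -> : rect A B `&` Y a t @^-1` B' = rect A B1.
  apply/seteqP; split => w.
    move=> [/rect_eventP h wB]; apply/rect_eventP => i ik.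
    have [hA hB] := h i ik; split => // s sT; rewrite /B1.
    by case: andP => [[/eqP -> /eqP ->]//|_]; exact: hB.
  move=> /rect_eventP h; split.
    apply/rect_eventP => i ik; have [hA hB] := h i ik; split => // s sT.
    by have := hB s sT; rewrite /B1; case: andP => [[/eqP -> /eqP ->]|//]; rewrite Bat.
  by have [_ /(_ t tT)] := h a ak; rewrite /B1 !eqxx.
rewrite lawE// (rect_prob_bigD1 _ ak)//.
have -> : (\prod_(i < k | i != a :> nat) \int[Gam]_(x in A i) (lik (B1 i) x)%:E)%E = Cm%:E.
  rewrite -CE; apply: eq_bigr => i ia; apply: eq_integral => x _.
  by congr (_%:E); apply: eq_bigr => s _; rewrite /B1 (negbTE ia).
have lik1 x : lik (B1 a) x = lik (B a) x * fine (Pk x B').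
  rewrite /lik (bigD1 (Ordinal tT))//= [in RHS](bigD1 (Ordinal tT))//= Bat.
  rewrite probability_setT /= mul1r mulrC /B1 !eqxx /=; congr (_ * _).
  apply: eq_bigr => s st; case: ifP => // /eqP sE.
  by case/eqP: st; exact: val_inj.
pose g x := lik (B a) x * \1_(A a) x.
pose mE := measurable_rect_event law mA mB.
(* The law of [mu a] restricted to the rectangle. It has density [Cm * g] with respect to the prior,
   so the right-hand side becomes an integral over the prior. *)
pose nu : {measure set R -> \bar R} :=
  measure_function_pushforward__canonical__measure_function_Measure (mrestr P mE) (mmu a).
have nuE A' : measurable A' -> nu A' = (Cm%:E * \int[Gam]_(x in A') (g x)%:E)%E.
  move=> mA'; rewrite -[nu A']/(P (mu a @^-1` A' `&` rect A B)).
  have -> : mu a @^-1` A' `&` rect A B = rect (A1 A') B.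
    apply/seteqP; split => w.
      move=> [wA' /rect_eventP h]; apply/rect_eventP => i ik.
      have [hA hB] := h i ik; split => //; rewrite /A1.
      by case: eqP hA => // ->.
    move=> /rect_eventP h; split.
      by have [+ _] := h a ak; rewrite /A1 eqxx => -[].
    apply/rect_eventP => i ik; have [hA hB] := h i ik; split => //.
    by move: hA; rewrite /A1; case: eqP => // -> [].
  rewrite lawE//; last exact: mA1.
  rewrite (rect_prob_bigD1 _ ak)//; congr (_ * _)%E.
    rewrite -CE; apply: eq_bigr => i ia; by rewrite /A1 (negbTE ia).
  rewrite /A1 eqxx setIC integral_mkcondr; apply: eq_integral => x _.
  by rewrite epatch_indic /g EFinM.
have mh : measurable_fun setT (fun x => Pk x B') by exact: mPk.
have g01 x : 0 <= g x <= 1.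
  by rewrite /g indicE; case: (_ \in _); rewrite ?mulr1 ?mulr0 ?lik_ge0 ?lik_le1 ?lexx ?ler01.
transitivity (\int[nu]_x Pk x B')%E; last first.
  rewrite /nu ge0_integral_pushforward//; last first.
  have mE1 : measurable_fun setT (\1_(rect A B) : Om -> R) by exact: measurable_indic.
  rewrite (@ge0_integral_density _ _ _ P _ _ _ mE1 _ 1)//.
  - rewrite mul1e [RHS]integral_mkcond; apply: eq_integral => w _ /=.
    by rewrite muleC epatch_indic.
  - move=> A' mA'; rewrite mul1e integral_indic//.
    by rewrite /mrestr setIC.
  - exact: measurableT_comp.
rewrite (@ge0_integral_density _ _ _ Gam g _ _ _ nu Cm)//.
- congr (_ * _)%E; rewrite integral_mkcond; apply: eq_integral => x _.
  by rewrite epatch_indic lik1 EFinM fineK ?Pk_fin// /g EFinM muleAC.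
- by move=> x; have /andP[] := g01 x.
- by move=> x; have /andP[] := g01 x.
- by apply: measurable_funM => //; exact: measurable_lik.
Qed.

End one_step.

(** * Conditional law of the next reward given the past *)

Section one_step_integral.
Context (R : realType) (Gam : probability R R) (Pk : R -> probability R R).
Context (k T : nat) d (Om : measurableType d) (P : probability Om R).
Context (mu : nat -> Om -> R) (Y : nat -> nat -> Om -> R).
Hypothesis mPk : forall B, measurable B -> measurable_fun setT (fun m => Pk m B).
Hypothesis law : bandit_law P Gam Pk k T mu Y.

Local Notation Fs t := (g_sigma_algebraType (past k T mu Y t)).

(** Supplies the pi-system on which the two joint laws of past and next reward are compared in
    [integral_one_step]. *)
Lemma past_prod_gen t : @measurable _ (Fs t * R)%type =
  <<s [set A `*` B | A in past k T mu Y t & B in measurable] >>.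
Proof.
rewrite measurable_prod_measurableType; apply/seteqP; split; last first.
  apply: smallest_sub; first exact: smallest_sigma_algebra.
  move=> _ [A pA [B mB <-]]; apply: sub_sigma_algebra.
  by exists A; [exact: sub_sigma_algebra|exists B].
set G := [set _ | _ in past _ _ _ _ _ & _ in _].
apply: smallest_sub; first exact: smallest_sigma_algebra.
move=> _ [A mA [B mB <-]].
have -> : A `*` B = (A `*` setT) `&` (setT `*` B).
  by apply/seteqP; split => -[x y] /=; tauto.
apply: (@measurableI _ (g_sigma_algebraType G)); last first.
  by apply: sub_sigma_algebra; exists setT; [exact: past_setT|exists B].
have : preimage_set_system [set: Om * R] fst <<s past k T mu Y t >> (A `*` setT).
  by exists A => //; rewrite setTI; apply/seteqP; split => -[x y] /=; tauto.
(* Preimages under [fst] of a generated sigma-algebra are generated by the preimages of its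
   generators, so only E in [past] has to be treated. *)
rewrite -g_sigma_preimageE; apply: smallest_sub; first exact: smallest_sigma_algebra.
move=> _ [E pE <-]; apply: sub_sigma_algebra; exists E => //; exists setT => //.
by rewrite setTI; apply/seteqP; split => -[x y] /=; tauto.
Qed.

Variables (a t : nat).
Hypotheses (ak : (a < k)%N) (tT : (t < T)%N).

(** The source carries the sigma-algebra of the past rather than the ambient one, so that
    integrating out the reward leaves a function measurable in the past. *)
Definition reward_kernel (w : Fs t) : {measure set R -> \bar R} := Pk (mu a w).

Let measurable_reward_kernel B : measurable B ->
  measurable_fun [set: Fs t] (reward_kernel ^~ B).
Proof.
move=> mB; apply: (measurableT_comp (f := fun x => Pk x B)); first exact: mPk.
exact: measurable_past_mu.
Qed.

HB.instance Definition _ :=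
  @isKernel.Build _ _ (Fs t) R R reward_kernel measurable_reward_kernel.

Let reward_kernel_setT w : reward_kernel w setT = 1%E.
Proof. exact: probability_setT. Qed.

HB.instance Definition _ :=
  Kernel_isProbability.Build _ _ (Fs t) R R reward_kernel reward_kernel_setT.

Lemma measurable_integral_reward (Phi : Om * R -> \bar R) :
  measurable_fun (setT : set (Fs t * R)) Phi -> (forall z, 0 <= Phi z)%E ->
  measurable_fun (setT : set (Fs t)) (fun w => \int[Pk (mu a w)]_y Phi (w, y))%E.
Proof.
by move=> mPhi Phi0; 
  exact: (@measurable_fun_integral_finite_kernel _ _ (Fs t) R R Phi reward_kernel Phi0 mPhi).
Qed.

Let mpair (w : Fs t) : measurable_fun [set: R] (fun y => (w, y)).
Proof. exact: pair1_measurable. Qed.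

Let joint (w : Om) : giry (Fs t * R)%type R := giry_map (mpair w) (Pk (mu a w)).

Let measurable_joint : measurable_fun [set: Om] joint.
Proof.
apply: measurable_giry_codensity => // B mB.
apply: (@measurable_past_fun_sub _ _ _ _ _ _ _ _ _ _ law t).
rewrite (_ : (fun _ => _) = (fun w => \int[Pk (mu a w)]_y (\1_B (w, y))%:E)%E).
  apply: (measurable_integral_reward (Phi := fun z => (\1_B z)%:E)).
    by apply/measurable_EFinP.
  by move=> z; rewrite lee_fin.
apply/funext => w; rewrite -[in LHS](setIT B) -integral_indic//.
rewrite -[LHS]/(giry_int _ _) giry_int_map//.
exact/measurable_EFinP.
Qed.

(** This is the tower property: given the past, [Y a t] has law [Pk (mu a w)]. The law of the pair
    (past, next reward) and the law obtained by drawing a fresh reward agree on rectangles by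
    [prob_rect_reward], hence everywhere by uniqueness of measures. *)
Lemma integral_one_step (Phi : Om * R -> \bar R) :
  measurable_fun (setT : set (Fs t * R)) Phi -> (forall z, 0 <= Phi z)%E ->
  (\int[P]_w Phi (w, Y a t w) = \int[P]_w \int[Pk (mu a w)]_y Phi (w, y))%E.
Proof.
move=> mPhi Phi0; have [mmu [mY _]] := law.
have mZ : measurable_fun [set: Om] (fun w => (w : Fs t, Y a t w)).
  apply: measurable_fun_pair; last exact: mY.
  by move=> _ E mE; rewrite setTI; exact: (measurable_past_sub law mE).
transitivity (\int[pushforward P (fun w => (w : Fs t, Y a t w))]_z Phi z)%E.
  by rewrite ge0_integral_pushforward.
transitivity (\int[giry_bind (P : giry Om R) measurable_joint]_z Phi z)%E; last first.
  rewrite -[LHS]/(giry_int _ _) giry_int_bind//; apply: eq_integral => w _.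
  by rewrite /joint giry_int_map.
apply: eq_measure_integral => S mS _.
apply: (@measure_unique _ R (Fs t * R)%type [set A `*` B | A in past k T mu Y t & B in measurable]
  (fun=> setT)) => //.
- exact: past_prod_gen.
- move=> _ _ [A pA [B mB <-]] [A' pA' [B' mB' <-]].
  exists (A `&` A'); first exact: past_setI.
  by exists (B `&` B'); [exact: measurableI|rewrite setXI].
- move=> _; exists setT; first exact: past_setT.
  by exists setT => //; rewrite setXTT.
- by rewrite bigcup_const//; exists 0%N.
- move=> _ [E pE [B mB <-]].
  have mEB : measurable ((E : set (Fs t)) `*` B).
    by apply: measurableX => //; exact: sub_sigma_algebra.
  transitivity (\int[giry_bind (P : giry Om R) measurable_joint]_z
      (\1_(E `*` B) z)%:E)%E; last by rewrite integral_indic// setIT.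
  rewrite -[RHS]/(giry_int _ _) giry_int_bind//; last exact/measurable_EFinP.
  transitivity (\int[P]_(w in E) Pk (mu a w) B)%E.
    case: pE => A [B0 [mA mB0 tB0 ->]].
    by rewrite -(prob_rect_reward mPk law ak tT mA mB0 (tB0 a t (leqnn t)) mB).
  rewrite integral_mkcond; apply: eq_integral => w _.
  rewrite /joint giry_int_map//; last exact/measurable_EFinP.
  rewrite /giry_int epatch_indic /=.
  transitivity (\int[Pk (mu a w)]_x ((\1_E w)%:E * (\1_B x)%:E))%E.
    rewrite ge0_integralZl_EFin//; last exact/measurable_EFinP.
    by rewrite integral_indic// setIT muleC.
  by apply: eq_integral => x _; rewrite -EFinM !indicE in_setX/= -natrM mulnb.
- move=> _; rewrite -[X in (X < _)%E]/(P ((fun w => (w : Fs t, Y a t w)) @^-1` setT)).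
  by rewrite preimage_setT probability_setT ltry.
Qed.

End one_step_integral.

(** * Law of the means and the subgaussian one-step inequality *)

Section one_step_subgaussian.
Context (R : realType) (Gam : probability R R) (Pk : R -> probability R R).
Context (k T : nat) d (Om : measurableType d) (P : probability Om R).
Context (mu : nat -> Om -> R) (Y : nat -> nat -> Om -> R).
Hypothesis Gam01 : Gam [set x | 0 <= x <= 1] = 1%E.
Hypothesis fam : reward_family Pk.
Hypothesis law : bandit_law P Gam Pk k T mu Y.

Local Notation Fs t := (g_sigma_algebraType (past k T mu Y t)).

Let itv01E : [set x : R | 0 <= x <= 1] = `[0, 1]%classic.
Proof. by apply/seteqP; split => x /=; rewrite in_itv. Qed.

Lemma prob_means (A : nat -> set R) : (forall i, measurable (A i)) ->
  P [set w | forall i, (i < k)%N -> A i (mu i w)] = (\prod_(i < k) Gam (A i))%E.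
Proof.
move=> mA; have [_ [_ lawE]] := law.
have -> : [set w | forall i, (i < k)%N -> A i (mu i w)] =
    rect_event k T mu Y A (fun _ _ => setT).
  apply/seteqP; split => w.
    by move=> h; apply/rect_eventP => i ik; split => //; exact: h.
  by move=> /rect_eventP h i ik; have [] := h i ik.
rewrite lawE// /rect_prob; apply: eq_bigr => i _.
transitivity (\int[Gam]_(x in A i) cst 1%E x)%E; last by rewrite integral_cst// mul1e.
by apply: eq_integral => x _; rewrite big1// => s _; rewrite probability_setT.
Qed.

Lemma prob_mean a B : (a < k)%N -> measurable B -> P (mu a @^-1` B) = Gam B.
Proof.
move=> ak mB; transitivity
  (P [set w | forall i, (i < k)%N -> (if i == a then B else setT) (mu i w)]).
  congr (P _); apply/seteqP; split => w /=.
    by move=> Bw i ik; case: eqP => [->|].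
  by move=> /(_ a ak); rewrite eqxx.
rewrite (prob_means (A := fun i => if i == a then B else setT)); last by move=> i; case: ifP.
rewrite (bigD1 (Ordinal ak))//= eqxx big1 ?mule1// => i ia.
by rewrite ifF ?probability_setT//; apply/negbTE; apply: contraNN ia => /eqP ia; apply/eqP/val_inj.
Qed.

Lemma integral_mean a (h : R -> \bar R) : (a < k)%N -> measurable_fun setT h ->
  (forall x, 0 <= h x)%E -> (\int[P]_w h (mu a w) = \int[Gam]_x h x)%E.
Proof.
move=> ak mh h0; have [mmu _] := law.
transitivity (\int[pushforward P (mu a)]_x h x)%E.
  by rewrite ge0_integral_pushforward.
apply: eq_measure_integral => A mA _; exact: prob_mean.
Qed.

Lemma ae_means01 : {ae P, forall w, forall i, (i < k)%N -> 0 <= mu i w <= 1}.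
Proof.
have [mmu _] := law.
have h i : (i < k)%N -> {ae P, forall w, 0 <= mu i w <= 1}.
  move=> ik; exists (mu i @^-1` (~` [set x | 0 <= x <= 1])); split.
  - rewrite -[X in measurable X]setTI; apply: mmu => //.
    by apply: measurableC; rewrite itv01E.
  - rewrite prob_mean//; last by apply: measurableC; rewrite itv01E.
    by rewrite probability_setC ?Gam01 ?subee//= itv01E.
  - by move=> w /=.
apply: ae_foralln => i; have [ik|ik] := ltnP i k; last by apply: aeW => w.
by apply: filterS (h i ik) => w.
Qed.

(** The weight [F] and the rate [l] may be random: both are fixed by the past, so the subgaussian
    bound applies inside the integral over the fresh reward. The comparison is almost sure because
    the bound is assumed only for means in [0, 1]. *)
Lemma one_step_subgaussian a t (F l : Om -> R) : (a < k)%N -> (t < T)%N ->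
  measurable_fun (setT : set (Fs t)) F -> measurable_fun (setT : set (Fs t)) l ->
  (forall w, 0 <= F w) ->
  (\int[P]_w (F w * expR (l w * (Y a t w - mu a w)))%:E <=
   \int[P]_w (F w * expR (l w ^+ 2 / 2))%:E)%E.
Proof.
move=> ak tT mF ml F0; have [mPk [_ sub]] := fam.
have mmu := @measurable_past_mu _ k T _ _ mu Y t a ak.
pose Phi (z : Om * R) := (F z.1 * expR (l z.1 * (z.2 - mu a z.1)))%:E.
have mfst : measurable_fun (setT : set (Fs t * R)) (fst : Fs t * R -> Fs t) by [].
have mPhi : measurable_fun (setT : set (Fs t * R)) Phi.
  apply/measurable_EFinP; apply: measurable_funM.
    exact: (measurableT_comp mF).
  apply: measurableT_comp => //; apply: measurable_funM.
    exact: (measurableT_comp ml).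
  apply: measurable_funB => //; exact: (measurableT_comp mmu).
have Phi0 z : (0 <= Phi z)%E by rewrite lee_fin mulr_ge0// expR_ge0.
rewrite -[leLHS]/(\int[P]_w Phi (w, Y a t w))%E.
rewrite (integral_one_step mPk law ak tT mPhi Phi0).
have msub := @measurable_past_fun_sub _ _ _ _ _ _ _ _ _ _ law t.
apply: ae_ge0_le_integral => //.
- by move=> w _; apply: integral_ge0.
- by apply: msub; exact: (measurable_integral_reward mPk ak mPhi Phi0).
- by move=> w _; rewrite lee_fin mulr_ge0// expR_ge0.
- apply: msub; apply/measurable_EFinP; apply: measurable_funM => //.
  apply: measurableT_comp => //; apply: measurable_funM => //.
  exact: measurable_funX.
- apply: filterS ae_means01 => w /(_ a ak) m01 _.
  rewrite /Phi /=; under eq_integral do rewrite EFinM.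
  rewrite ge0_integralZl_EFin//; last first.
    apply/measurable_EFinP; apply: measurableT_comp => //.
    by apply: measurable_funM => //; apply: measurable_funB.
  by rewrite EFinM lee_wpmul2l ?lee_fin//; exact: sub.
Qed.

End one_step_subgaussian.

(** * The greedy algorithm *)

Section greedy_facts.
Context (R : realType).
Implicit Types (f : nat -> R) (y : nat -> nat -> R) (h : seq nat).

Definition reward_sum y h (i : nat) : R :=
  \sum_(s < size h | nth 0%N h s == i) y i s.

Lemma reward_sum_rcons y h a i :
  reward_sum y (rcons h a) i =
  reward_sum y h i + (if a == i then y i (size h) else 0).
Proof.
rewrite /reward_sum size_rcons big_mkcond big_ord_recr /= nth_rcons ltnn eqxx.
congr (_ + _); rewrite [RHS]big_mkcond; apply: eq_bigr => s _.
by rewrite nth_rcons ltn_ord.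
Qed.

Lemma count_rcons (T : Type) (p : pred T) s x :
  count p (rcons s x) = (count p s + p x)%N.
Proof. by rewrite -cats1 count_cat /= addn0. Qed.

Lemma argmax_first_le f n : (argmax_first f n <= n.-1)%N.
Proof.
elim: n => // n ih /=; case: ifP => // _.
by rewrite (leq_trans ih)// leq_pred.
Qed.

Lemma argmax_firstP f n i : (i < n)%N -> f i <= f (argmax_first f n).
Proof.
elim: n => // n ih; rewrite ltnS leq_eqVlt => /orP[/eqP ->|/ih fi] /=.
  by case: ifPn => //; rewrite -leNgt.
by case: ifPn => // /ltW; exact: le_trans.
Qed.

Lemma size_greedy_hist k y t : size (greedy_hist k y t) = t.
Proof. by elim: t => //= t ih; rewrite size_rcons ih. Qed.

Lemma greedy_actionE k y t : greedy_action k y t =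
  if (t < k)%N then t else argmax_first (emp_mean y (greedy_hist k y t)) k.
Proof. by rewrite /greedy_action /= nth_rcons size_greedy_hist ltnn eqxx. Qed.

Lemma greedy_histS k y t :
  greedy_hist k y t.+1 = rcons (greedy_hist k y t) (greedy_action k y t).
Proof. by rewrite greedy_actionE. Qed.

Lemma greedy_action_lt k y t : (0 < k)%N -> (greedy_action k y t < k)%N.
Proof.
move=> k0; rewrite greedy_actionE; case: ifP => // _.
by rewrite -(prednK k0) ltnS prednK// argmax_first_le.
Qed.

Lemma greedy_hist_init k y t : (t <= k)%N -> greedy_hist k y t = iota 0 t.
Proof.
elim: t => // t ih tk; rewrite greedy_histS greedy_actionE tk ih ?(ltnW tk)//.
by rewrite -addn1 iotaD cats1.
Qed.

Lemma count_greedy_init k y t : (t < k)%N ->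
  count (pred1 t) (greedy_hist k y t) = 0%N.
Proof.
move=> tk; rewrite greedy_hist_init ?(ltnW tk)//.
by apply/count_memPn; rewrite mem_iota ltnn andbF.
Qed.

Lemma count_greedy_gt0 k y t i : (k <= t)%N -> (i < k)%N ->
  (0 < count (pred1 i) (greedy_hist k y t))%N.
Proof.
move=> kt ik; rewrite -(subnKC kt); elim: (t - k)%N => [|n ih].
  by rewrite addn0 greedy_hist_init// -has_count has_pred1 mem_iota.
by rewrite addnS greedy_histS count_rcons ltn_addr.
Qed.

Lemma measurable_argmax_first d (X : measurableType d) (g : nat -> X -> R) n :
  (forall i, (i < n)%N -> measurable_fun setT (g i)) ->
  forall a, measurable [set w | argmax_first (g ^~ w) n = a].
Proof.
elim: n => [|n ih] mg a /=.
  have [->|a0] := eqVneq a 0%N.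
    by rewrite (_ : [set _ | _] = setT)//; apply/seteqP.
  rewrite (_ : [set _ | _] = set0)//; apply/seteqP; split => // w /= a0'.
  by rewrite -a0' eqxx in a0.
rewrite (_ : [set _ | _] = \bigcup_(j in `I_n.+1)
   ([set w | argmax_first (g ^~ w) n = j] `&`
    [set w | (if g j w < g n w then n else j) = a])); last first.
  apply/seteqP; split => w /=.
    move=> ha; exists (argmax_first (g ^~ w) n) => //=.
    by rewrite ltnS (leq_trans (argmax_first_le _ _))// leq_pred.
  by move=> [j _ [/= -> ]].
apply: bigcup_measurable => j jn; apply: measurableI.
  by apply: ih => i iN; apply: mg; rewrite ltnW.
have mlt : measurable_fun setT (fun w => g j w < g n w).
  by apply: measurable_fun_ltr; apply: mg.
have -> : [set w | (if g j w < g n w then n else j) = a] =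
    setT `&` (fun w => g j w < g n w) @^-1` [set b | (if b then n else j) = a].
  by rewrite setTI.
by apply: mlt.
Qed.

End greedy_facts.

Section greedy_measurable.
Context (R : realType) (k T : nat) d (Om : measurableType d).
Context (mu : nat -> Om -> R) (Y : nat -> nat -> Om -> R).
Hypothesis k0 : (0 < k)%N.

Local Notation Fs t := (g_sigma_algebraType (past k T mu Y t)).
Local Notation hist t w := (greedy_hist k (fun i s => Y i s w) t).
Local Notation act t w := (greedy_action k (fun i s => Y i s w) t).
Local Notation rsum i t w := (reward_sum (fun i s => Y i s w) (hist t w) i).
Local Notation pulls i t w := ((count (pred1 i) (hist t w))%:R : R).

(** Half of a mutual induction: statistics at time [t] determine the action at time [t], which
    determines the statistics at time t + 1. *)
Let measurable_act_of_stats t :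
  (forall i, (i < k)%N -> measurable_fun (setT : set (Fs t)) (fun w => rsum i t w) /\
    measurable_fun (setT : set (Fs t)) (fun w => pulls i t w)) ->
  forall a, measurable ([set w | act t w = a] : set (Fs t)).
Proof.
move=> ms a.
have -> : [set w | act t w = a] =
   [set w | (if (t < k)%N then t else
     argmax_first (fun i => emp_mean (fun i s => Y i s w) (hist t w) i) k) = a].
  by apply/seteqP; split => w /=; rewrite greedy_actionE.
case: ltnP => tk.
  have [->|ta] := eqVneq t a.
    by rewrite (_ : [set _ | _] = setT)//; apply/seteqP.
  rewrite (_ : [set _ | _] = set0)//; apply/seteqP; split => // w /= ta'.
  by rewrite ta' eqxx in ta.
apply: (@measurable_argmax_first _ _ (Fs t)
  (fun i w => emp_mean (fun i s => Y i s w) (hist t w) i)) => i ik.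
have [mr mp] := ms i ik.
apply: measurable_funM => //.
(* The inverse is read as the power -1, a measurable function; the two agree on non-negative counts,
   including at 0 where both are 0. *)
rewrite (_ : (fun _ => _) = (fun w => pulls i t w `^ (-1))); last first.
  by apply/funext => w; rewrite powR_inv1.
exact: (measurableT_comp (measurable_powR (-1))).
Qed.

Lemma measurable_greedy_stats t : (t <= T)%N ->
  forall i, (i < k)%N -> measurable_fun (setT : set (Fs t)) (fun w => rsum i t w) /\
    measurable_fun (setT : set (Fs t)) (fun w => pulls i t w).
Proof.
elim: t => [|t ih] tT i ik.
  split; last by [].
  rewrite (_ : (fun _ => _) = (fun=> 0))//.
  by apply/funext => w; rewrite /reward_sum /= big_ord0.
have ms := ih (ltnW tT); have [mr mp] := ms i ik.
have ma := measurable_act_of_stats ms i.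
have mle d' (U : measurableType d') (f : Om -> U) := @measurable_past_fun_le R k T _ Om mu Y t t.+1 d' U f (leqnSn t).
have mind : measurable_fun (setT : set (Fs t)) (\1_([set w | act t w = i]) : Om -> R).
  exact: measurable_indic.
split.
  rewrite (_ : (fun _ => _) =
    (fun w => rsum i t w + \1_([set w | act t w = i]) w * Y i t w)); last first.
    apply/funext => w; rewrite greedy_histS reward_sum_rcons size_greedy_hist.
    rewrite indicE; case: eqP => [e|e].
      by rewrite mem_set// mul1r.
    by rewrite memNset// mul0r.
  apply: measurable_funD; first exact: mle.
  apply: measurable_funM; first exact: mle.
  exact: measurable_past_Y.
rewrite (_ : (fun _ => _) =
  (fun w => pulls i t w + \1_([set w | act t w = i]) w)); last first.
  apply/funext => w; rewrite greedy_histS count_rcons natrD /=.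
  rewrite indicE; case: eqP => [e|e].
    by rewrite mem_set.
  by rewrite memNset.
by apply: measurable_funD; exact: mle.
Qed.

(** Predictability: the arm chosen at time [t] does not look at the rewards of time [t]. *)
Lemma measurable_greedy_action t a : (t <= T)%N ->
  measurable ([set w | act t w = a] : set (Fs t)).
Proof.
by move=> tT; apply: measurable_act_of_stats => i; exact: measurable_greedy_stats.
Qed.

End greedy_measurable.

(** * Potentials *)

Section potential.
Context (R : realType) (Gam : probability R R) (Pk : R -> probability R R).
Context (k T : nat) d (Om : measurableType d) (P : probability Om R).
Context (mu : nat -> Om -> R) (Y : nat -> nat -> Om -> R).
Hypothesis Gam01 : Gam [set x | 0 <= x <= 1] = 1%E.
Hypothesis fam : reward_family Pk.
Hypothesis law : bandit_law P Gam Pk k T mu Y.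
Hypothesis k0 : (0 < k)%N.

Local Notation Fs t := (g_sigma_algebraType (past k T mu Y t)).
Local Notation act t w := (greedy_action k (fun i s => Y i s w) t).

(** One step of a supermartingale with payoff: [V] and [V'] are the potential before and after the
    pull, [D] the amount it must release. It suffices to bound [V'] by an exponential in the reward
    of the pulled arm whose subgaussian average, plus [D], stays below [V]. The proof sums over the
    pulled arm. *)
Lemma potential_step t (V V' D : Om -> R) (F l : nat -> Om -> R) : (t < T)%N ->
  measurable_fun setT V -> measurable_fun setT V' -> measurable_fun setT D ->
  (forall a, (a < k)%N -> measurable_fun (setT : set (Fs t)) (F a)) ->
  (forall a, (a < k)%N -> measurable_fun (setT : set (Fs t)) (l a)) ->
  (forall a w, 0 <= F a w) -> (forall w, 0 <= V' w) -> (forall w, 0 <= D w) ->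
  (forall w, let a := act t w in
     V' w <= F a w * expR (l a w * (Y a t w - mu a w))) ->
  (forall w, let a := act t w in F a w * expR (l a w ^+ 2 / 2) + D w <= V w) ->
  (\int[P]_w (V' w)%:E + \int[P]_w (D w)%:E <= \int[P]_w (V w)%:E)%E.
Proof.
move=> tT mV mV' mD mF ml F0 V'0 D0 stepV' stepV.
have [mmu [mY _]] := law.
have msub := @measurable_past_fun_sub _ _ _ _ _ _ _ _ _ _ law t.
pose ind a : Om -> R := \1_([set w | act t w = a]).
have mindF a : measurable_fun (setT : set (Fs t)) (ind a).
  by apply: measurable_indic; apply: measurable_greedy_action; exact: ltnW.
have mind a : measurable_fun setT (ind a) by apply: msub.
have ind0 a w : 0 <= ind a w by rewrite /ind indicE; case: (_ \in _).
(* Exactly one indicator is 1, so the sum over arms evaluates [G] at the random action. *)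
have indE (G : nat -> Om -> R) w : \sum_(a < k) ind a w * G a w = G (act t w) w.
  rewrite (bigD1 (Ordinal (greedy_action_lt (fun i s => Y i s w) t k0)))//=.
  rewrite /ind indicE mem_set//= mul1r big1 ?addr0// => a ha.
  rewrite indicE memNset ?mul0r//= => actE; move/eqP: ha; apply.
  by apply: val_inj; rewrite /= actE.
have mG1 a : (a < k)%N ->
    measurable_fun setT (fun w => ind a w * F a w * expR (l a w * (Y a t w - mu a w))).
  move=> ak; apply: measurable_funM.
    by apply: measurable_funM => //; apply: msub; exact: mF.
  apply: measurableT_comp => //; apply: measurable_funM; first by apply: msub; exact: ml.
  exact: measurable_funB.
have mG2 a : (a < k)%N ->
    measurable_fun setT (fun w => ind a w * F a w * expR (l a w ^+ 2 / 2)).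
  move=> ak; apply: measurable_funM.
    by apply: measurable_funM => //; apply: msub; exact: mF.
  apply: measurableT_comp => //; apply: measurable_funM => //.
  by apply: measurable_funX; apply: msub; exact: ml.
have G0 a w x : 0 <= ind a w * F a w * expR x by rewrite !mulr_ge0// expR_ge0.
have le1 : (\int[P]_w (V' w)%:E <= \sum_(a < k)
    \int[P]_w (ind a w * F a w * expR (l a w * (Y a t w - mu a w)))%:E)%E.
  rewrite -ge0_integral_sum//; last 2 first.
  - by move=> a; apply/measurable_EFinP; exact: mG1.
  - by move=> a w _; rewrite lee_fin.
  apply: ge0_le_integral => //.
  - by move=> w _; rewrite lee_fin.
  - exact/measurable_EFinP.
  - apply: emeasurable_sum => a; apply/measurable_EFinP; exact: mG1.
  - move=> w _; rewrite sumEFin lee_fin.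
    under eq_bigr do rewrite -mulrA.
    by rewrite (indE (fun a w => F a w * expR (l a w * (Y a t w - mu a w)))).
have le2 : (\sum_(a < k)
    \int[P]_w (ind a w * F a w * expR (l a w * (Y a t w - mu a w)))%:E <=
    \int[P]_w (\sum_(a < k) (ind a w * F a w * expR (l a w ^+ 2 / 2))%:E))%E.
  rewrite ge0_integral_sum//; last 2 first.
  - by move=> a; apply/measurable_EFinP; exact: mG2.
  - by move=> a w _; rewrite lee_fin.
  apply: lee_sum => a _; apply: (one_step_subgaussian Gam01 fam law) => //.
  - by apply: measurable_funM => //; exact: mF.
  - exact: ml.
  - by move=> w; rewrite mulr_ge0.
apply: (le_trans (leeD (le_trans le1 le2) (lexx _))).
rewrite -ge0_integralD//; last 4 first.
- by move=> w _; apply: sume_ge0 => a _; rewrite lee_fin.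
- by apply: emeasurable_sum => a; apply/measurable_EFinP; exact: mG2.
- by move=> w _; rewrite lee_fin.
- exact/measurable_EFinP.
apply: ge0_le_integral => //.
- move=> w _; apply: adde_ge0; last by rewrite lee_fin.
  by apply: sume_ge0 => a _; rewrite lee_fin.
- apply: emeasurable_funD; last exact/measurable_EFinP.
  by apply: emeasurable_sum => a; apply/measurable_EFinP; exact: mG2.
- exact/measurable_EFinP.
- move=> w _; rewrite sumEFin -EFinD lee_fin.
  under eq_bigr do rewrite -mulrA.
  by rewrite (indE (fun a w => F a w * expR (l a w ^+ 2 / 2))).
Qed.

End potential.

(** * One-arm estimates for the survival potential *)

Section survival_potential.
Context (R : realType) (dl : R).
Hypothesis dl0 : 0 < dl.
Implicit Types m s n y : R.

Let theta : R := 1 - 2 * dl.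

(* The first pull is played with rate dl instead of 2 * dl: this is where the
   factor exp (- dl ^ 2 / 2) < 1 of an unpulled good arm comes from. *)
Definition survival_pot m s n : R :=
  if m < 1 - dl then 1 else if n == 0 then expR (- (dl ^+ 2 / 2))
  else Num.min 1 (expR (- (2 * dl) * (s - n * theta))).

(** [pot_rate] and [pot_scale] describe an exponential majorant of the potential after one more
    pull. For a good arm already pulled, rate 0 is enough while the empirical mean is below [theta],
    since the potential then equals its cap 1; otherwise the exponential branch is followed. *)
Definition pot_rate m s n : R :=
  if m < 1 - dl then 0 else if n == 0 then - dl
  else if 0 <= s - n * theta then - (2 * dl) else 0.

Definition pot_scale m s n : R :=
  if m < 1 - dl then 1 else if n == 0 then expR (- dl * (m - theta))
  else if 0 <= s - n * theta
  then expR (- (2 * dl) * (s - n * theta) - 2 * dl * (m - theta)) else 1.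

Lemma survival_pot_ge0 m s n : 0 <= survival_pot m s n.
Proof.
rewrite /survival_pot; case: ifP => // _; case: ifP => _; first exact: expR_ge0.
by rewrite le_min ler01 expR_ge0.
Qed.

Lemma pot_scale_ge0 m s n : 0 <= pot_scale m s n.
Proof.
by rewrite /pot_scale; case: ifP => // _; case: ifP => _;
  [|case: ifP => // _]; exact: expR_ge0.
Qed.

Lemma survival_pot_pull m s n y : 0 <= n -> (n = 0 -> s = 0) ->
  survival_pot m (s + y) (n + 1) <=
  pot_scale m s n * expR (pot_rate m s n * (y - m)).
Proof.
move=> n0 ns; rewrite /survival_pot /pot_scale /pot_rate; case: ifPn => _.
  by rewrite mul0r expR0 mulr1.
rewrite gt_eqF ?ltr_wpDl//.
case: eqP => [nE|_].
  rewrite nE ns// !add0r mul1r -expRD ge_min.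
  have -> : - dl * (m - theta) + - dl * (y - m) = dl * (theta - y) by ring.
  (* The inequality is min (1, u^2) <= u with u = expR (dl * (theta - y)); which branch of the
     minimum serves depends on the sign of y - theta. *)
  have [yt|yt] := leP theta y; last first.
    by apply/orP; left; rewrite -[leLHS]expR0 ler_expR mulr_ge0 ?subr_ge0 ?ltW.
  apply/orP; right; rewrite ler_expR -subr_ge0.
  have -> : dl * (theta - y) - - (2 * dl) * (y - theta) = dl * (y - theta) by ring.
  by rewrite mulr_ge0 ?subr_ge0//; exact: ltW.
case: ifPn => sn; last by rewrite mul0r expR0 mulr1 ge_min lexx.
rewrite -expRD ge_min ler_expR; apply/orP; right.
by rewrite le_eqVlt; apply/orP; left; apply/eqP; rewrite /theta; ring.
Qed.

(** A good arm has m - theta >= dl, so a pull at rate - lambda multiplies the expected exponential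
    by at most exp (lambda^2 / 2 - lambda * dl). This is 1 at lambda = 2 * dl, the rate of later
    pulls, and smallest, exp (- dl^2 / 2), at lambda = dl, the rate of the first pull. *)
Lemma pot_scale_rate m s n :
  pot_scale m s n * expR (pot_rate m s n ^+ 2 / 2) <= survival_pot m s n.
Proof.
rewrite /survival_pot /pot_scale /pot_rate; case: ifPn => [_|].
  by rewrite expr0n /= mul0r expR0 mulr1.
rewrite -leNgt => m1; case: eqP => [_|_].
  rewrite -expRD ler_expR -subr_ge0.
  have -> : - (dl ^+ 2 / 2) - (- dl * (m - theta) + (- dl) ^+ 2 / 2) =
    dl * (m - (1 - dl)) by rewrite /theta; field.
  by rewrite mulr_ge0 ?subr_ge0//; exact: ltW.
case: ifPn => sn; last first.
  rewrite expr0n /= mul0r expR0 mulr1 le_min lexx/= -[leLHS]expR0 ler_expR.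
  by rewrite mulNr -mulrN mulr_ge0// ?oppr_ge0 ltW// ?mulr_gt0// ltNge.
rewrite -expRD.
have -> : - (2 * dl) * (s - n * theta) - 2 * dl * (m - theta) + (- (2 * dl)) ^+ 2 / 2 =
  - (2 * dl) * (s - n * theta) - 2 * dl * (m - (1 - dl)) by rewrite /theta; field.
have h1 : 0 <= 2 * dl * (s - n * theta) by rewrite mulr_ge0// mulr_ge0// ltW.
have h2 : 0 <= 2 * dl * (m - (1 - dl)) by rewrite !mulr_ge0 ?subr_ge0//; exact: ltW.
rewrite le_min -[X in _ <= X]expR0 !ler_expR mulNr; apply/andP; split; lra.
Qed.

End survival_potential.

Section survival_measurable.
Context (R : realType) (dl : R) d (X : measurableType d).
Variables (m s n : X -> R).
Hypotheses (mm : measurable_fun setT m) (ms : measurable_fun setT s)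
  (mn : measurable_fun setT n).

Lemma measurable_survival_pot :
  measurable_fun setT (fun w => survival_pot dl (m w) (s w) (n w)).
Proof.
apply: measurable_fun_ifT => //; first exact: measurable_fun_ltr.
apply: measurable_fun_ifT => //; first exact: measurable_fun_eqr.
apply: measurable_minr => //; apply: measurableT_comp => //.
apply: measurable_funM => //; apply: measurable_funB => //.
exact: measurable_funM.
Qed.

Lemma measurable_pot_rate :
  measurable_fun setT (fun w => pot_rate dl (m w) (s w) (n w)).
Proof.
apply: measurable_fun_ifT => //; first exact: measurable_fun_ltr.
apply: measurable_fun_ifT => //; first exact: measurable_fun_eqr.
apply: measurable_fun_ifT => //; apply: measurable_fun_ler => //.
by apply: measurable_funB => //; exact: measurable_funM.
Qed.

Lemma measurable_pot_scale :
  measurable_fun setT (fun w => pot_scale dl (m w) (s w) (n w)).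
Proof.
have msn : measurable_fun setT (fun w => s w - n w * (1 - 2 * dl)).
  by apply: measurable_funB => //; exact: measurable_funM.
apply: measurable_fun_ifT => //; first exact: measurable_fun_ltr.
apply: measurable_fun_ifT => //; first exact: measurable_fun_eqr.
  apply: measurableT_comp => //; apply: measurable_funM => //.
  exact: measurable_funB.
apply: measurable_fun_ifT => //; first exact: measurable_fun_ler.
apply: measurableT_comp => //; apply: measurable_funB => //.
  exact: measurable_funM.
apply: measurable_funM => //; exact: measurable_funB.
Qed.

End survival_measurable.

(** * The product of the survival potentials over all arms *)

Section arm_potentials.
Context (R : realType) (Gam : probability R R) (Pk : R -> probability R R).
Context (k T : nat) d (Om : measurableType d) (P : probability Om R).
Context (mu : nat -> Om -> R) (Y : nat -> nat -> Om -> R).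
Hypothesis Gam01 : Gam [set x | 0 <= x <= 1] = 1%E.
Hypothesis fam : reward_family Pk.
Hypothesis law : bandit_law P Gam Pk k T mu Y.
Hypothesis k0 : (0 < k)%N.
Variable dl : R.
Hypothesis dl0 : 0 < dl.

Local Notation Fs t := (g_sigma_algebraType (past k T mu Y t)).
Local Notation hist t w := (greedy_hist k (fun i s => Y i s w) t).
Local Notation act t w := (greedy_action k (fun i s => Y i s w) t).
Local Notation rsum i t w := (reward_sum (fun i s => Y i s w) (hist t w) i).
Local Notation pulls i t w := ((count (pred1 (i : nat)) (hist t w))%:R : R).

Let rsum0 i t w : pulls i t w = 0 -> rsum i t w = 0.
Proof.
move=> /eqP; rewrite pnatr_eq0 => /eqP/count_memPn ni.
rewrite /reward_sum big1// => s /eqP si; move/negP: ni; case.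
by rewrite -si mem_nth.
Qed.

Let pulls_step i t w :
  pulls i t.+1 w = pulls i t w + (act t w == i)%:R.
Proof. by rewrite greedy_histS count_rcons natrD. Qed.

Let rsum_step i t w : rsum i t.+1 w = rsum i t w + (if act t w == i then Y i t w else 0).
Proof. by rewrite greedy_histS reward_sum_rcons size_greedy_hist. Qed.

Let mstats t i : (t <= T)%N -> (i < k)%N ->
  measurable_fun (setT : set (Fs t)) (fun w => rsum i t w) /\
  measurable_fun (setT : set (Fs t)) (fun w => pulls i t w).
Proof. by move=> tT; exact: measurable_greedy_stats. Qed.

Definition survival_prod t w : R :=
  \prod_(i < k) survival_pot dl (mu i w) (rsum i t w) (pulls i t w).

Lemma survival_prod_ge0 t w : 0 <= survival_prod t w.
Proof. by apply: prodr_ge0 => i _; exact: survival_pot_ge0. Qed.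

Lemma measurable_survival_prod t : (t <= T)%N -> measurable_fun setT (survival_prod t).
Proof.
move=> tT; apply: (@measurable_past_fun_sub _ _ _ _ _ _ _ _ _ _ law t).
apply: (@measurable_prod _ (Fs t)) => i _.
have [mr mp] := mstats tT (ltn_ord i).
by apply: measurable_survival_pot => //; exact: measurable_past_mu.
Qed.

Lemma integral_survival_prod_le t : (t <= T)%N ->
  (\int[P]_w (survival_prod t w)%:E <= \int[P]_w (survival_prod 0 w)%:E)%E.
Proof.
elim: t => // t ih tT; apply: le_trans (ih (ltnW tT)).
(* Only the factor of the pulled arm is replaced by its majorant; the others are unchanged by the
   step. *)
pose F a w := \prod_(i < k) (if i == a :> nat
  then pot_scale dl (mu i w) (rsum i t w) (pulls i t w)
  else survival_pot dl (mu i w) (rsum i t w) (pulls i t w)).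
pose l a w := pot_rate dl (mu a w) (rsum a t w) (pulls a t w).
pose rest a w := \prod_(i < k | i != a :> nat)
  survival_pot dl (mu i w) (rsum i t w) (pulls i t w).
have FE a w : (a < k)%N ->
    F a w = pot_scale dl (mu a w) (rsum a t w) (pulls a t w) * rest a w.
  move=> ak; rewrite /F (bigD1 (Ordinal ak))//= eqxx; congr (_ * _).
  by apply: eq_bigr => i ia; rewrite ifN.
have rest0 a w : 0 <= rest a w by apply: prodr_ge0 => i _; exact: survival_pot_ge0.
have actk w : (act t w < k)%N by exact: greedy_action_lt.
have := @potential_step R Gam Pk k T d Om P mu Y Gam01 fam law k0 t
  (survival_prod t) (survival_prod t.+1) (fun=> 0) F l tT.
rewrite integral0 adde0; apply => //.
- by apply: measurable_survival_prod; exact: ltnW.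
- exact: measurable_survival_prod.
- move=> a ak; apply: (@measurable_prod _ (Fs t)) => i _.
  have [mr mp] := mstats (ltnW tT) (ltn_ord i).
  have mm := @measurable_past_mu R k T _ _ mu Y t i (ltn_ord i).
  case: (_ == _).
    exact: (@measurable_pot_scale _ dl _ (Fs t)).
  exact: (@measurable_survival_pot _ dl _ (Fs t)).
- move=> a ak; have [mr mp] := mstats (ltnW tT) ak.
  by apply: measurable_pot_rate => //; exact: measurable_past_mu.
- move=> a w; apply: prodr_ge0 => i _.
  by case: ifP => _; [exact: pot_scale_ge0|exact: survival_pot_ge0].
- by move=> w; exact: survival_prod_ge0.
- move=> w; cbv zeta; rewrite FE// /survival_prod (bigD1 (Ordinal (actk w)))//=.
  rewrite mulrAC ler_pM//.
  + exact: survival_pot_ge0.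
  + by apply: prodr_ge0 => i _; exact: survival_pot_ge0.
  + by rewrite rsum_step pulls_step eqxx; apply: survival_pot_pull => // /rsum0.
  + rewrite le_eqVlt; apply/orP; left; apply/eqP; apply: eq_bigr => i ia.
    have ai : (act t w == i) = false.
      by apply/negbTE; apply: contraNN ia => /eqP e; apply/eqP/val_inj.
    by rewrite rsum_step pulls_step ai !addr0.
- move=> w; cbv zeta; rewrite addr0 FE// /survival_prod (bigD1 (Ordinal (actk w)))//=.
  by rewrite mulrAC ler_wpM2r//; exact: pot_scale_rate.
Qed.

(** Before any pull each factor is r + (1 - r) * 1_(mu i < 1 - dl). Independence of the means is
    known for intersections of events, so the product is expanded over the sets [J] of arms
    contributing their indicator, integrated termwise and folded back. *)
Lemma integral_survival_prod0 (p : R) : Gam [set x | x < 1 - dl] = p%:E ->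
  (\int[P]_w (survival_prod 0 w)%:E =
   ((expR (- (dl ^+ 2 / 2)) + (1 - expR (- (dl ^+ 2 / 2))) * p) ^+ k)%:E)%E.
Proof.
move=> pE; set r := expR _.
have r1 : 0 <= 1 - r.
  by rewrite subr_ge0 -[leRHS]expR0 ler_expR oppr_le0 divr_ge0// sqr_ge0.
have mL : measurable [set x : R | x < 1 - dl].
  have -> : [set x : R | x < 1 - dl] = `]-oo, 1 - dl[%classic.
    by apply/seteqP; split => x /=; rewrite in_itv.
  exact: measurable_itv.
have [mmu _] := law.
pose A (J : {set 'I_k}) : set Om := [set w | forall i : 'I_k, i \in J -> mu i w < 1 - dl].
pose c (J : {set 'I_k}) : R := \prod_(i < k) (if i \in J then 1 - r else r).
have c0 J : 0 <= c J.
  by apply: prodr_ge0 => i _; case: ifP => // _; exact: expR_ge0.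
have AE J : A J = [set w | forall i, (i < k)%N ->
    (if [exists j : 'I_k, (j == i :> nat) && (j \in J)]
     then [set x : R | x < 1 - dl] else setT) (mu i w)].
  apply/seteqP; split => w /= h.
    move=> i ik; case: ifPn => // /existsP[j /andP[/eqP <- jJ]]; exact: h.
  move=> i iJ; have := h i (ltn_ord i); rewrite ifT//.
  by apply/existsP; exists i; rewrite eqxx.
have exE (J : {set 'I_k}) (i : 'I_k) :
    [exists j : 'I_k, (j == i :> nat) && (j \in J)] = (i \in J).
  apply/existsP/idP => [[j /andP[/eqP/val_inj <-//]]|iJ].
  by exists i; rewrite eqxx.
have PA J : P (A J) = (\prod_(i < k) (if i \in J then p else 1))%:E.
  rewrite AE (prob_means law (A := fun i => if [exists j : 'I_k, (j == i :> nat) && (j \in J)]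
     then [set x : R | x < 1 - dl] else setT)); last by move=> i; case: ifP.
  rewrite -prodEFin; apply: eq_bigr => i _; rewrite exE.
  by case: ifP => // _; rewrite probability_setT.
have mA J : measurable (A J).
  rewrite (_ : A J = \big[setI/setT]_(i in J) (mu i @^-1` [set x | x < 1 - dl])).
    by apply: bigsetI_measurable => i _; rewrite -[X in measurable X]setTI; exact: mmu.
  rewrite -bigcap_seq_cond; apply/seteqP; split => w h i /=.
    by move=> /andP[_ iJ]; exact: h.
  by move=> iJ; apply: h; rewrite /= mem_index_enum.
have potE w : survival_prod 0 w = \sum_(J : {set 'I_k}) c J * \1_(A J) w.
  transitivity (\prod_(i < k) ((1 - r) * \1_([set w | mu i w < 1 - dl]) w + r)).
    apply: eq_bigr => i _; rewrite /survival_pot /= eqxx indicE.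
    case: ifPn => h; first by rewrite mem_set//= mulr1 subrK.
    by rewrite memNset ?mulr0 ?add0r//=; apply/negP.
  rewrite bigA_distr; apply: eq_bigr => J _.
  rewrite /c indicE; case: (boolP (w \in A J)) => [/set_mem h|h].
    rewrite mulr1; apply: eq_bigr => i _; case: ifP => // iJ.
    by rewrite indicE mem_set ?mulr1//; exact: h.
  rewrite mulr0.
  have /existsP[i /andP[iJ hi]] : [exists i : 'I_k, (i \in J) && ~~ (mu i w < 1 - dl)].
    apply: contraR h; rewrite negb_exists => /forallP h.
    apply/mem_set => i iJ; have := h i; rewrite iJ /= negbK; exact: id.
  rewrite (bigD1 i)//= iJ indicE memNset ?mulr0 ?mul0r//=; exact/negP.
under eq_integral do rewrite potE -sumEFin.
rewrite ge0_integral_sum//; last 2 first.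
- by move=> J; apply/measurable_EFinP; apply: measurable_funM => //; exact: measurable_indic.
- by move=> J w _; rewrite lee_fin mulr_ge0.
transitivity (\sum_(J : {set 'I_k}) (\prod_(i < k) (if i \in J then (1 - r) * p else r))%:E)%E.
  apply: eq_bigr => J _; under eq_integral do rewrite EFinM.
  rewrite ge0_integralZl_EFin//; last by apply/measurable_EFinP; exact: measurable_indic.
  rewrite (integral_indic _ _ (mA J))// setIT.
  transitivity ((c J)%:E * (\prod_(i < k) (if i \in J then p else 1))%:E)%E.
    by congr (_ * _)%E; exact: PA.
  rewrite -EFinM /c -big_split /=; congr (_%:E).
  by apply: eq_bigr => i _; case: ifP => // _; rewrite mulr1.
rewrite sumEFin -bigA_distr prodr_const card_ord; congr (_%:E).
by rewrite [in RHS]addrC.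
Qed.

End arm_potentials.

(** * Expected regret from pulls of overrated bad arms *)

Section bad_arms.
Context (R : realType) (Gam : probability R R) (Pk : R -> probability R R).
Context (k T : nat) d (Om : measurableType d) (P : probability Om R).
Context (mu : nat -> Om -> R) (Y : nat -> nat -> Om -> R).
Hypothesis Gam01 : Gam [set x | 0 <= x <= 1] = 1%E.
Hypothesis fam : reward_family Pk.
Hypothesis law : bandit_law P Gam Pk k T mu Y.
Hypothesis k0 : (0 < k)%N.
Variable dl : R.
Hypothesis dl0 : 0 < dl.

Local Notation Fs t := (g_sigma_algebraType (past k T mu Y t)).
Local Notation hist t w := (greedy_hist k (fun i s => Y i s w) t).
Local Notation act t w := (greedy_action k (fun i s => Y i s w) t).
Local Notation rsum i t w := (reward_sum (fun i s => Y i s w) (hist t w) i).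
Local Notation pulls i t w := ((count (pred1 (i : nat)) (hist t w))%:R : R).

(* Means lie in [0, 1] only almost surely; the clipping makes the gap bounded
   everywhere. *)
Definition gap (x : R) : R := if 0 <= x <= 1 then 1 - x else 0.

Lemma gap_ge0 x : 0 <= gap x.
Proof. by rewrite /gap; case: ifP => // /andP[_]; rewrite subr_ge0. Qed.

Lemma gap_le1 x : gap x <= 1.
Proof. by rewrite /gap; case: ifP => // /andP[x0 _]; rewrite lerBlDr lerDl. Qed.

Lemma measurable_gap : measurable_fun setT gap.
Proof.
apply: measurable_fun_ifT => //; last exact: measurable_funB.
by apply: measurable_and; apply: measurable_fun_ler.
Qed.

Definition excess (x : R) : R := 1 - 2 * dl - x.

(** The gap times the bound on the expected number of overrated pulls. Arms within 3 * dl of 1 get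
    weight 0: their regret is charged to the term 3 * dl per round. *)
Definition bad_weight (x : R) : R :=
  if x < 1 - 3 * dl then gap x / (1 - expR (- (excess x ^+ 2 / 2))) else 0.

Let excess_gt0 (x : R) : x < 1 - 3 * dl -> 0 < excess x.
Proof. by move=> h; rewrite subr_gt0; apply: lt_le_trans h _; have h1 := dl0; lra. Qed.

Let denom_gt0 (x : R) : x < 1 - 3 * dl -> 0 < 1 - expR (- (excess x ^+ 2 / 2)).
Proof.
move=> h; rewrite subr_gt0 -[ltRHS]expR0 ltr_expR oppr_lt0 divr_gt0//.
by rewrite exprn_gt0// excess_gt0.
Qed.

Lemma bad_weight_ge0 x : 0 <= bad_weight x.
Proof.
rewrite /bad_weight; case: ifP => // h.
by rewrite divr_ge0 ?gap_ge0// ltW// denom_gt0.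
Qed.

Lemma measurable_excess : measurable_fun setT excess.
Proof. exact: measurable_funB. Qed.

Lemma measurable_bad_weight : measurable_fun setT bad_weight.
Proof.
rewrite (_ : bad_weight = fun x => if x < 1 - 3 * dl then
   gap x * (1 - expR (- (excess x ^+ 2 / 2))) `^ (-1) else 0); last first.
  apply/funext => x; rewrite /bad_weight; case: ifP => // h.
  by rewrite powR_inv1// ltW// denom_gt0.
apply: measurable_fun_ifT => //; first exact: measurable_fun_ltr.
apply: measurable_funM; first exact: measurable_gap.
apply: (measurableT_comp (measurable_powR (-1))).
apply: measurable_funB => //; apply: measurableT_comp => //.
apply: measurableT_comp => //; apply: measurable_funM => //.
by apply: measurable_funX; exact: measurable_excess.
Qed.

(** The empirical mean is compared with the threshold without division, so an arm never pulled (both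
    sides 0) passes the test. The pulls of the initial round over all arms are thereby counted
    here. *)
Definition bad_pull a t w : R :=
  if (act t w == a) && ((mu a w < 1 - 3 * dl) &&
     (pulls a t w * (1 - 2 * dl) <= rsum a t w)) then gap (mu a w) else 0.

Lemma bad_pull_ge0 a t w : 0 <= bad_pull a t w.
Proof. by rewrite /bad_pull; case: ifP => // _; exact: gap_ge0. Qed.

Let mstats t i : (t <= T)%N -> (i < k)%N ->
  measurable_fun (setT : set (Fs t)) (fun w => rsum i t w) /\
  measurable_fun (setT : set (Fs t)) (fun w => pulls i t w).
Proof. by move=> tT; exact: measurable_greedy_stats. Qed.

Lemma measurable_bad_pull a t : (a < k)%N -> (t <= T)%N ->
  measurable_fun setT (bad_pull a t).
Proof.
move=> ak tT; apply: (@measurable_past_fun_sub _ _ _ _ _ _ _ _ _ _ law t).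
have [mr mp] := mstats tT ak; have mm := @measurable_past_mu R k T _ _ mu Y t a ak.
apply: (@measurable_fun_ifT _ _ (Fs t)) => //; last first.
  by apply: measurableT_comp => //; exact: measurable_gap.
apply: measurable_and.
  apply: (measurable_fun_bool true); rewrite setTI.
  rewrite (_ : _ @^-1` _ = [set w | act t w = a]).
    exact: measurable_greedy_action.
  by apply/seteqP; split => w /= /eqP.
apply: measurable_and; first exact: measurable_fun_ltr.
by apply: measurable_fun_ler => //; apply: measurable_funM.
Qed.

(** The exponent equals excess * (S - n * (1 - 2 * dl)), hence is non-negative exactly when a bad
    arm passes the test of [bad_pull]. A pull multiplies the expected potential by at most exp (-
    excess^2 / 2). *)
Let bad_potential a t w : R := bad_weight (mu a w) *
  expR (excess (mu a w) * (rsum a t w - pulls a t w * mu a w)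
        - pulls a t w * excess (mu a w) ^+ 2).

Let bad_potential_ge0 a t w : 0 <= bad_potential a t w.
Proof. by rewrite mulr_ge0 ?bad_weight_ge0 ?expR_ge0. Qed.

Let measurable_bad_potential a t : (a < k)%N -> (t <= T)%N ->
  measurable_fun (setT : set (Fs t)) (bad_potential a t).
Proof.
move=> ak tT; have [mr mp] := mstats tT ak.
have mm := @measurable_past_mu R k T _ _ mu Y t a ak.
have me : measurable_fun (setT : set (Fs t)) (fun w => excess (mu a w)).
  by apply: measurableT_comp => //; exact: measurable_excess.
apply: measurable_funM.
  by apply: measurableT_comp => //; exact: measurable_bad_weight.
apply: measurableT_comp => //; apply: measurable_funB.
  apply: measurable_funM => //; apply: measurable_funB => //.
  exact: measurable_funM.
apply: measurable_funM => //; exact: measurable_funX.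
Qed.

Lemma bad_pulls_le a n : (a < k)%N -> (n <= T)%N ->
  (\sum_(t < n) \int[P]_w (bad_pull a t w)%:E <=
   \int[Gam]_x (bad_weight x)%:E)%E.
Proof.
move=> ak nT.
(* The remaining potential is kept on the left so that the induction telescopes, and is dropped only
   at the end. *)
suff h : (\int[P]_w (bad_potential a n w)%:E +
    \sum_(t < n) \int[P]_w (bad_pull a t w)%:E <=
    \int[Gam]_x (bad_weight x)%:E)%E.
  apply: le_trans h; rewrite leeDr// integral_ge0// => w _.
  by rewrite lee_fin.
have msub t := @measurable_past_fun_sub _ _ _ _ _ _ _ _ _ _ law t.
elim: n nT => [|n ih] nT.
  rewrite big_ord0 adde0.
  rewrite -(integral_mean law ak (h := fun x => (bad_weight x)%:E)); last 2 first.
  - by apply/measurable_EFinP; exact: measurable_bad_weight.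
  - by move=> x; rewrite lee_fin bad_weight_ge0.
  rewrite le_eqVlt; apply/orP; left; apply/eqP; apply: eq_integral => w _.
  by rewrite /bad_potential /reward_sum /= big_ord0 !mul0r !subr0 ?mulr0 ?subr0 expR0 mulr1.
apply: le_trans (ih (ltnW nT)); rewrite big_ord_recr /= addeA addeAC leeD//.
pose F b w := if b == a
  then bad_potential a n w * expR (- excess (mu a w) ^+ 2) else bad_potential a n w.
pose l b w := if b == a then excess (mu a w) else 0.
have mm := @measurable_past_mu R k T _ _ mu Y n a ak.
have me : measurable_fun (setT : set (Fs n)) (fun w => excess (mu a w)).
  by apply: measurableT_comp => //; exact: measurable_excess.
apply: (potential_step Gam01 fam law k0 (F := F) (l := l) nT) => //.
- by apply: msub; apply: measurable_bad_potential => //; exact: ltnW.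
- by apply: msub; apply: measurable_bad_potential.
- by apply: measurable_bad_pull => //; exact: ltnW.
- move=> b bk; rewrite /F; case: eqP => _; last first.
    by apply: measurable_bad_potential => //; exact: ltnW.
  apply: measurable_funM; first by apply: measurable_bad_potential => //; exact: ltnW.
  by apply: measurableT_comp => //; apply: measurableT_comp => //; exact: measurable_funX.
- by move=> b bk; rewrite /l; case: eqP.
- by move=> b w; rewrite /F; case: eqP => // _; rewrite mulr_ge0// expR_ge0.
- by move=> w; exact: bad_pull_ge0.
- move=> w; cbv zeta; rewrite /bad_potential greedy_histS count_rcons natrD.
  rewrite reward_sum_rcons size_greedy_hist /F /l /=; case: eqP => [->|_].
    rewrite /bad_potential -!mulrA ler_wpM2l ?bad_weight_ge0//.
    rewrite -!expRD ler_expR le_eqVlt; apply/orP; left; apply/eqP; rewrite /= mulr1n; ring.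
  by rewrite /= mulr0n !addr0 mul0r expR0 mulr1.
- move=> w; cbv zeta; rewrite /bad_pull /F /l; case: eqP => [_|_]/=; last first.
    by rewrite expr0n /= mul0r expR0 mulr1 addr0.
  rewrite -mulrA -expRD.
  have -> : - excess (mu a w) ^+ 2 + excess (mu a w) ^+ 2 / 2 =
    - (excess (mu a w) ^+ 2 / 2) by field.
  set E := expR _; have E1 : E <= 1.
    by rewrite -[leRHS]expR0 ler_expR oppr_le0 divr_ge0// sqr_ge0.
  case: ifPn => [/andP[bad enough]|_]; last by rewrite addr0 ler_piMr.
  rewrite -lerBrDl -{1}[bad_potential a n w]mulr1 -mulrBr.
  (* The denominator of the weight cancels the relative decrease, leaving the gap times an
     exponential that is at least 1. *)
  rewrite /bad_potential /bad_weight bad mulrAC divfK ?gt_eqF ?denom_gt0//.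
  rewrite ler_peMr ?gap_ge0// -[leLHS]expR0 ler_expR.
  have -> : excess (mu a w) * (rsum a n w - pulls a n w * mu a w)
    - pulls a n w * excess (mu a w) ^+ 2 =
    excess (mu a w) * (rsum a n w - pulls a n w * (1 - 2 * dl)) by rewrite /excess; ring.
  by apply: mulr_ge0; [exact: ltW (excess_gt0 bad)|rewrite subr_ge0].
Qed.

End bad_arms.

(** * Regret bounds *)

Section greedy_gap.
Context (R : realType) (Gam : probability R R) (Pk : R -> probability R R).
Context (k T : nat) d (Om : measurableType d) (P : probability Om R).
Context (mu : nat -> Om -> R) (Y : nat -> nat -> Om -> R).
Hypothesis Gam01 : Gam [set x | 0 <= x <= 1] = 1%E.
Hypothesis fam : reward_family Pk.
Hypothesis law : bandit_law P Gam Pk k T mu Y.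
Hypothesis k0 : (0 < k)%N.

Local Notation hist t w := (greedy_hist k (fun i s => Y i s w) t).
Local Notation act t w := (greedy_action k (fun i s => Y i s w) t).
Local Notation rsum i t w := (reward_sum (fun i s => Y i s w) (hist t w) i).
Local Notation pulls i t w := ((count (pred1 (i : nat)) (hist t w))%:R : R).

Lemma measurable_mean_action (g : R -> R) t : (t <= T)%N -> measurable_fun setT g ->
  measurable_fun setT (fun w => g (mu (act t w) w)).
Proof.
move=> tT mg; have [mmu _] := law.
rewrite (_ : (fun _ => _) =
    (fun w => \sum_(a < k) \1_([set w | act t w = a]) w * g (mu a w))); last first.
  apply/funext => w; have ak := greedy_action_lt (fun i s => Y i s w) t k0.
  rewrite (bigD1 (Ordinal ak))//= indicE mem_set//= mul1r big1 ?addr0// => a ha.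
  rewrite indicE memNset ?mul0r//= => actE; move/eqP: ha; apply.
  by apply: val_inj; rewrite /= actE.
apply: measurable_sum => a; apply: measurable_funM; last exact: measurableT_comp.
apply: measurable_indic.
by apply: (measurable_past_sub law (t := t)); exact: measurable_greedy_action.
Qed.

(** Three cases for the pulled arm: its mean is within 3 * dl of 1; it is bad but passes the
    threshold test; or its empirical mean is below the threshold. In the last case, greediness puts
    every empirical mean below the threshold, so every survival factor is 1, which dominates any
    gap. *)
Lemma gap_action_le dl t w : 0 < dl ->
  gap (mu (act t w) w) <=
  3 * dl + survival_prod k mu Y dl t w + \sum_(a < k) bad_pull k mu Y dl a t w.
Proof.
move=> dl0; set a := act t w.
have ak : (a < k)%N by exact: greedy_action_lt.
have bad0 b : 0 <= bad_pull k mu Y dl b t w by exact: bad_pull_ge0.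
have sum0 : 0 <= \sum_(b < k) bad_pull k mu Y dl b t w by exact: sumr_ge0.
have sp0 := survival_prod_ge0 k mu Y dl t w.
have [bad|good] := ltP (mu a w) (1 - 3 * dl); last first.
  apply: (@le_trans _ _ (3 * dl)); last by rewrite -addrA lerDl addr_ge0.
  rewrite /gap; case: ifP => _; first by rewrite lerBlDr -lerBlDl.
  by rewrite mulr_ge0// ltW.
have [enough|few] := leP (pulls a t w * (1 - 2 * dl)) (rsum a t w).
  apply: (@le_trans _ _ (bad_pull k mu Y dl a t w)).
    by rewrite /bad_pull eqxx bad enough.
  rewrite (bigD1 (Ordinal ak))//= [leRHS]addrCA lerDl.
  by apply: addr_ge0; [rewrite addr_ge0// mulr_ge0// ltW|exact: sumr_ge0].
(* An unpulled arm would have passed the test, so this arm was pulled before and the initial round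
   is over. *)
have pa : (0 < count (pred1 a) (hist t w))%N.
  rewrite lt0n; apply/eqP => c0; move: few; rewrite c0 mul0r /reward_sum big1 ?ltxx//.
  move=> s /eqP sa; move/count_memPn/negP: c0; case.
  by rewrite -sa mem_nth.
have kt : (k <= t)%N.
  rewrite leqNgt; apply/negP => tk; move: pa.
  by rewrite /a greedy_actionE tk count_greedy_init.
have fewi i : (i < k)%N -> rsum i t w < pulls i t w * (1 - 2 * dl).
  move=> ik; have pi := count_greedy_gt0 (fun i s => Y i s w) kt ik.
  rewrite mulrC -ltr_pdivrMr ?ltr0n//.
  have am : emp_mean (fun i s => Y i s w) (hist t w) i <=
            emp_mean (fun i s => Y i s w) (hist t w) a.
    by rewrite /a greedy_actionE ltnNge kt /=; exact: argmax_firstP.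
  apply: (le_lt_trans am); rewrite /emp_mean ltr_pdivrMr ?ltr0n//.
  by rewrite mulrC.
have -> : survival_prod k mu Y dl t w = 1.
  apply: big1 => i _; rewrite /survival_pot; case: ifP => // _.
  have pi := count_greedy_gt0 (fun i s => Y i s w) kt (ltn_ord i).
  rewrite pnatr_eq0 gtn_eqF//; apply/min_idPl.
  rewrite -[leLHS]expR0 ler_expR mulNr -mulrN mulr_ge0//; first by rewrite mulr_ge0// ltW.
  by rewrite oppr_ge0 subr_le0 ltW// fewi.
apply: (le_trans (gap_le1 _)).
by rewrite addrAC -[X in X <= _]add0r lerD// addr_ge0// mulr_ge0// ltW.
Qed.

Lemma integral_gap_le dl p : 0 < dl -> Gam [set x | x < 1 - dl] = p%:E ->
  (\int[P]_w (\sum_(t < T) gap (mu (act t w) w))%:E <=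
   (3 * dl * T%:R + T%:R *
     (expR (- (dl ^+ 2 / 2)) + (1 - expR (- (dl ^+ 2 / 2))) * p) ^+ k)%:E +
   k%:R%:E * \int[Gam]_x (bad_weight dl x)%:E)%E.
Proof.
move=> dl0 pE; set q := (_ + _) ^+ k.
have msp t : (t <= T)%N -> measurable_fun setT (fun w => (survival_prod k mu Y dl t w)%:E).
  by move=> tT; apply/measurable_EFinP; exact: (measurable_survival_prod law).
have mbp a t : (a < k)%N -> (t <= T)%N ->
    measurable_fun setT (fun w => (bad_pull k mu Y dl a t w)%:E).
  by move=> ak tT; apply/measurable_EFinP; exact: (measurable_bad_pull law).
have mgap t : (t <= T)%N -> measurable_fun setT (fun w => (gap (mu (act t w) w))%:E).
  by move=> tT; apply/measurable_EFinP; apply: measurable_mean_action => //; exact: measurable_gap.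
have step t : (t < T)%N ->
    (\int[P]_w (gap (mu (act t w) w))%:E <= (3 * dl + q)%:E +
     \sum_(a < k) \int[P]_w (bad_pull k mu Y dl a t w)%:E)%E.
  move=> tT.
  have h1 : (\int[P]_w (gap (mu (act t w) w))%:E <=
    \int[P]_w ((3 * dl)%:E + (survival_prod k mu Y dl t w)%:E +
      \sum_(a < k) (bad_pull k mu Y dl a t w)%:E))%E.
    apply: ge0_le_integral => //.
    - by move=> w _; rewrite lee_fin gap_ge0.
    - by apply: mgap; exact: ltnW.
    - apply: emeasurable_funD.
        by apply: emeasurable_funD => //; apply: msp; exact: ltnW.
      by apply: emeasurable_sum => a; apply: mbp => //; exact: ltnW.
    - by move=> w _; rewrite sumEFin -!EFinD lee_fin gap_action_le.
  apply: (le_trans h1).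
  rewrite ge0_integralD//; last 4 first.
  - by move=> w _; rewrite -EFinD lee_fin addr_ge0 ?survival_prod_ge0// mulr_ge0// ltW.
  - by apply: emeasurable_funD => //; apply: msp; exact: ltnW.
  - by move=> w _; apply: sume_ge0 => a _; rewrite lee_fin bad_pull_ge0.
  - by apply: emeasurable_sum => a; apply: mbp => //; exact: ltnW.
  rewrite ge0_integral_sum//; last 2 first.
  - by move=> a; apply: mbp => //; exact: ltnW.
  - by move=> a w _; rewrite lee_fin bad_pull_ge0.
  apply: leeD => //.
  rewrite ge0_integralD//; last 3 first.
  - by move=> w _; rewrite lee_fin mulr_ge0// ltW.
  - by move=> w _; rewrite lee_fin survival_prod_ge0.
  - by apply: msp; exact: ltnW.
  rewrite EFinD; apply: leeD; first by rewrite integral_cst//= [P _]probability_setT mule1.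
  apply: le_trans (integral_survival_prod_le Gam01 fam law k0 dl0 (ltnW tT)) _.
  by rewrite (integral_survival_prod0 law pE).
under eq_integral do rewrite -sumEFin.
rewrite [leLHS](ge0_integral_sum P measurableT
  (f := fun (t : 'I_T) w => (gap (mu (act t w) w))%:E)); last 2 first.
- by move=> t; apply: mgap; exact: ltnW.
- by move=> t w _; rewrite lee_fin gap_ge0.
apply: (@le_trans _ _ (\sum_(t < T) ((3 * dl + q)%:E +
     \sum_(a < k) \int[P]_w (bad_pull k mu Y dl a t w)%:E)))%E.
  by apply: lee_sum => t _; exact: step.
rewrite big_split /=; apply: leeD.
  rewrite sumEFin lee_fin sumr_const card_ord -[_ *+ T]mulr_natr mulrDl.
  by rewrite [q * _]mulrC.
rewrite exchange_big /=.
apply: (@le_trans _ _ (\sum_(a < k) \int[Gam]_x (bad_weight dl x)%:E))%E.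
  by apply: lee_sum => a _; exact: (bad_pulls_le Gam01 fam law k0 dl0).
by rewrite sumr_const card_ord mule_natl.
Qed.

End greedy_gap.

(** * Integrating the weight of bad arms against a 1-regular prior *)

Section bad_weight_integral.
Context (R : realType).

Lemma expRN1_ge : 3^-1 <= expR (-1) :> R.
Proof.
(* 6 is the least n with (1 - 1 / n)^n >= 1 / 3. *)
have -> : expR (-1) = expR (- 6^-1) ^+ 6 :> R.
  by rewrite -expRM_natl; congr expR; field.
have h : 5 / 6 <= expR (- 6^-1) :> R.
  by apply: le_trans (expR_ge1Dx _); lra.
have h6 : (5 / 6) ^+ 6 <= expR (- 6^-1) ^+ 6 :> R.
  by apply: lerXn2r => //; rewrite nnegrE ?expR_ge0//; lra.
by apply: le_trans h6; lra.
Qed.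

Lemma expRN_le_inv (z : R) : 0 <= z -> expR (- z) <= (1 + z)^-1.
Proof.
move=> z0; rewrite expRN lef_pV2 ?posrE ?expR_gt0 ?ltr_pwDl//.
exact: expR_ge1Dx.
Qed.

(** Origin of [C1]: at z = w^2 / 2 it gives 1 - exp (- w^2 / 2) >= C1 * w^2. The slope 2 / 3 fits
    between 1 - 1 / e and what 1 / (1 + z) allows, and the latter holds precisely up to z = 1 /
    2. *)
Lemma one_sub_expRN_ge (z : R) : 0 <= z -> z <= 2^-1 ->
  (1 - expR (-1)) * z <= 1 - expR (- z).
Proof.
move=> z0 z1; have e1 := expRN1_ge.
have h := expRN_le_inv z0.
have z2 : (1 + z)^-1 <= 1 - 2 / 3 * z.
  rewrite -(ler_pM2l (x := 1 + z)) ?ltr_pwDl// mulfV ?gt_eqF ?ltr_pwDl//; nra.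
have : (1 - expR (-1)) * z <= 2 / 3 * z by rewrite ler_wpM2r//; lra.
lra.
Qed.

(** The number of dyadic scales from [dl] to 1. The factor 3 exceeds 1 / ln 2 and suits the final
    bound: 3 * ln (1 / dl) is the logarithm of 1 / dl^3, the quantity appearing there. *)
Lemma dyadic_cover (dl : R) : 0 < dl -> dl <= 1 ->
  exists2 J : nat, 1 <= dl * 2 ^+ J & J%:R <= 1 + 3 * ln (dl^-1).
Proof.
move=> dl0 dl1; pose L := 3 * ln (dl^-1).
have L0 : 0 <= L by rewrite mulr_ge0// ln_ge0// invf_ge1.
have [J1 J2] := andP (truncn_itv L0).
exists (Num.truncn L).+1; last by rewrite -[_.+1]addn1 natrD addrC lerD2l.
set J := (Num.truncn L).+1.
have e2 : expR 3^-1 <= 2 :> R.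
  have h : 2 / 3 <= expR (- 3^-1) :> R by apply: le_trans (expR_ge1Dx _); lra.
  have e0 : 0 < expR 3^-1 :> R by exact: expR_gt0.
  have : expR 3^-1 * expR (- 3^-1) = 1 :> R by rewrite -expRD subrr expR0.
  nra.
have h2 : dl^-1 <= 2 ^+ J.
  rewrite -[leLHS]lnK ?posrE ?invr_gt0//.
  apply: (@le_trans _ _ (expR 3^-1 ^+ J)).
    rewrite -expRM_natl ler_expR.
    by rewrite -[X in _ <= X * _]/(J%:R) ler_pdivlMr// mulrC ltW.
  by apply: lerXn2r => //; rewrite nnegrE// expR_ge0.
by apply: le_trans (ler_wpM2l (ltW dl0) h2); rewrite mulfV ?lt0r_neq0.
Qed.

Variables (Gam : probability R R) (c0 C0 : R).
Hypothesis Gam01 : Gam [set x | 0 <= x <= 1] = 1%E.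
Hypothesis reg : one_regular Gam c0 C0.

Let ge_set (a : R) : [set x : R | a <= x] = `[a, +oo[%classic.
Proof. by apply/seteqP; split => x /=; rewrite in_itv /= andbT. Qed.

Let measurable_ge (a : R) : measurable [set x : R | a <= x].
Proof. by rewrite ge_set; exact: measurable_itv. Qed.

Lemma one_regular_C0_ge1 : 1 <= C0.
Proof.
have [_ [_ h]] := reg (e := 1) ltac:(by rewrite ltr01 lexx).
rewrite -lee_fin -Gam01 -[C0]mulr1; apply: le_trans h.
apply: le_measure; rewrite ?inE//.
  rewrite (_ : [set _ | _] = `[0, 1]%classic); first exact: measurable_itv.
  by apply/seteqP; split => x /=; rewrite in_itv.
by move=> x /= /andP[]; rewrite subrr.
Qed.

(** Extends regularity beyond 1, where C0 >= 1 makes it trivial; the widest dyadic level is wider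
    than 1. *)
Lemma upper_tail_le (v : R) : 0 < v -> (Gam [set x | (1 - v <= x)%R] <= (C0 * v)%:E)%E.
Proof.
move=> v0; have [v1|v1] := leP v 1.
  by have [_ []] := reg (e := v) ltac:(by rewrite v0 v1).
apply: (@le_trans _ _ 1%E); first exact: probability_le1.
rewrite lee_fin; have := one_regular_C0_ge1; nra.
Qed.

Variable dl : R.
Hypotheses (dl0 : 0 < dl) (dl3 : 3 * dl <= 1).

(* With w = excess dl x, the weight is at most (w + 2 dl) / w ^ 2 up to a
   constant; G j is the value of this bound at w = dl * 2 ^ j, and E j is the
   event w <= dl * 2 ^ j. *)
Let G (j : nat) : R := dl^-1 * ((2 ^+ j)^-1 + 2 * ((2 ^+ j)^-1) ^+ 2).
Let v (j : nat) : R := dl * (2 ^+ j + 2).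
Let E (j : nat) : set R := [set x | 1 - v j <= x].
(** Summation by parts: on E (j + 1) minus E j, with j < J, the value is [G j], but in this form
    only the tail probabilities of the nested sets [E] are needed. *)
Let step_fun (J : nat) (x : R) : R :=
  \sum_(j < J) (G j - G j.+1) * \1_(E j.+1) x + G J * \1_(E J) x.

Let pow2_gt0 j : 0 < 2 ^+ j :> R.
Proof. exact: exprn_gt0. Qed.

Let G_ge0 j : 0 <= G j.
Proof.
have := pow2_gt0 j => h.
by rewrite mulr_ge0 ?invr_ge0 ?addr_ge0 ?mulr_ge0 ?exprn_ge0 ?invr_ge0// ltW.
Qed.

Let G_le j : G j.+1 <= G j.
Proof.
have h := pow2_gt0 j.
have h1 : (2 ^+ j.+1)^-1 <= (2 ^+ j)^-1 :> R.
  by rewrite lef_pV2 ?posrE// ler_eXn2l// ltr1n.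
have h0 : 0 <= (2 ^+ j.+1)^-1 :> R by rewrite invr_ge0 ltW.
rewrite /G ler_wpM2l ?invr_ge0 ?(ltW dl0)// lerD// ler_wpM2l//.
by apply: lerXn2r; rewrite ?nnegrE// invr_ge0 ltW.
Qed.

Let step_fun_ge0 J x : 0 <= step_fun J x.
Proof.
apply: addr_ge0; last by apply: mulr_ge0 => //; exact: G_ge0.
apply: sumr_ge0 => j _; apply: mulr_ge0 => //; rewrite subr_ge0; exact: G_le.
Qed.

Let step_fun_dom J (x w : R) : w = excess dl x -> dl <= w -> w <= dl * 2 ^+ J ->
  (w + 2 * dl) / w ^+ 2 <= step_fun J x.
Proof.
move=> wE wdl; have w0 : 0 < w by exact: lt_le_trans wdl.
have gle j : dl * 2 ^+ j <= w -> (w + 2 * dl) / w ^+ 2 <= G j.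
  move=> jw; have p0 := pow2_gt0 j.
  have -> : (w + 2 * dl) / w ^+ 2 = w^-1 + 2 * dl * (w^-1) ^+ 2.
    by field; rewrite gt_eqF.
  have wi : w^-1 <= (dl * 2 ^+ j)^-1 by rewrite lef_pV2 ?posrE// mulr_gt0.
  have -> : G j = (dl * 2 ^+ j)^-1 + 2 * dl * ((dl * 2 ^+ j)^-1) ^+ 2.
    by rewrite /G; field; rewrite !gt_eqF.
  have w0i : 0 <= w^-1 by rewrite invr_ge0 ltW.
  rewrite lerD// ler_wpM2l//; first by rewrite mulr_ge0// ltW.
  by apply: lerXn2r => //; rewrite nnegrE ?(le_trans w0i wi).
have inE' j : w <= dl * 2 ^+ j -> \1_(E j) x = 1 :> R.
  move=> wj; rewrite indicE mem_set// /E /= /v; rewrite wE /excess in wj; lra.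
elim: J => [|J ih] wJ.
  rewrite /step_fun big_ord0 add0r inE'// mulr1; apply: gle.
  by rewrite expr0 mulr1.
have [wJ'|wJ'] := leP w (dl * 2 ^+ J).
  apply: le_trans (ih wJ') _; rewrite /step_fun big_ord_recr /= -addrA lerD2l.
  by rewrite !inE'// !mulr1 subrK.
rewrite /step_fun big_ord_recr /= !inE'// !mulr1 -addrA subrK.
apply: le_trans (gle J (ltW wJ')) _; rewrite lerDr sumr_ge0// => j _.
by apply: mulr_ge0 => //; rewrite subr_ge0; exact: G_le.
Qed.

Let integral_step_fun J :
  (\int[Gam]_x (step_fun J x)%:E <= (C0 * (13 + J%:R))%:E)%E.
Proof.
have v0 j : 0 < v j by rewrite mulr_gt0// addr_gt0.
have mE j : measurable (E j) by exact: measurable_ge.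
have h : (\int[Gam]_x (step_fun J x)%:E <=
   (\sum_(j < J) (G j - G j.+1) * (C0 * v j.+1) + G J * (C0 * v J))%:E)%E.
  have intE c j : 0 <= c ->
      (\int[Gam]_x (c * \1_(E j) x)%:E <= (c * (C0 * v j))%:E)%E.
    move=> c_ge0; under eq_integral do rewrite EFinM.
    rewrite ge0_integralZl_EFin//; last by apply/measurable_EFinP; exact: measurable_indic.
    rewrite (integral_indic _ _ (mE j))// setIT EFinM lee_wpmul2l ?lee_fin//.
    exact: upper_tail_le.
  under eq_integral do rewrite EFinD -sumEFin.
  have mterm c j : measurable_fun setT (fun x => (c * \1_(E j) x)%:E).
    by apply/measurable_EFinP; apply: measurable_funM => //; exact: measurable_indic.
  have Gd j : 0 <= G j - G j.+1 by rewrite subr_ge0.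
  rewrite ge0_integralD//; last 3 first.
  - by move=> x _; apply: sume_ge0 => j _; rewrite lee_fin; apply: mulr_ge0.
  - by apply: emeasurable_sum.
  - by move=> x _; rewrite lee_fin; apply: mulr_ge0 => //; exact: G_ge0.
  rewrite ge0_integral_sum//; last by move=> j x _; rewrite lee_fin; apply: mulr_ge0.
  rewrite EFinD -sumEFin; apply: leeD; last exact: intE.
  by apply: lee_sum => j _; exact: intE.
apply: le_trans h _; rewrite lee_fin.
(* The start is G 0 * C0 * v 0 = 9 * C0. Each further level adds G J * C0 * (v (J + 1) - v J) = C0 *
   (1 + 2 / 2^J): one unit plus a geometric series of sum 4, whence 13 = 9 + 4. *)
have -> : \sum_(j < J) (G j - G j.+1) * (C0 * v j.+1) + G J * (C0 * v J) =
    C0 * (13 + J%:R - 4 * (2 ^+ J)^-1).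
  elim: J => [|J ih].
    rewrite big_ord0 /G /v !expr0 invr1; field; exact: lt0r_neq0.
  rewrite big_ord_recr /= -addrA -mulrDl subrK.
  move: ih => /(congr1 (fun z => z - G J * (C0 * v J))); rewrite addrK => ->.
  rewrite /G /v (exprS 2 J) -(natr1 J); field.
  by rewrite !lt0r_neq0.
have C0_ge0 : 0 <= C0 by exact: le_trans one_regular_C0_ge1.
by rewrite ler_wpM2l// gerBl mulr_ge0// invr_ge0 ltW.
Qed.

Lemma integral_bad_weight_le :
  (\int[Gam]_x (bad_weight dl x)%:E <=
   (C0 / ((1 - expR (-1)) / 2) * (15 + 3 * ln (dl^-1)))%:E)%E.
Proof.
have dl1 : dl <= 1 by have := dl0; have := dl3; lra.
have [J J1 J2] := dyadic_cover dl0 dl1.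
pose C1 : R := (1 - expR (-1)) / 2.
have C1_gt0 : 0 < C1.
  by rewrite divr_gt0// subr_gt0 -[ltRHS]expR0 ltr_expR oppr_lt0.
have dom x : bad_weight dl x <= C1^-1 * step_fun J x.
  have rhs0 : 0 <= C1^-1 * step_fun J x by rewrite mulr_ge0// invr_ge0 ltW.
  rewrite /bad_weight; case: ifPn => // bad.
  rewrite /gap; case: ifPn => [/andP[x0 x1]|_]; last by rewrite mul0r.
  set w := excess dl x.
  have wdl : dl <= w by rewrite /w /excess; lra.
  have w1 : w <= 1 by rewrite /w /excess; have := dl0; lra.
  have w0 : 0 < w by exact: lt_le_trans wdl.
  have z1 : w ^+ 2 / 2 <= 2^-1.
    by rewrite -[leRHS]mul1r ler_wpM2r// expr_le1 // ltW.
  have z0 : 0 <= w ^+ 2 / 2 by rewrite divr_ge0// sqr_ge0.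
  have dge := one_sub_expRN_ge z0 z1.
  have C1w : 0 < C1 * w ^+ 2 by rewrite mulr_gt0// exprn_gt0.
  apply: (@le_trans _ _ ((1 - x) / (C1 * w ^+ 2))).
    rewrite ler_wpM2l ?subr_ge0// lef_pV2 ?posrE//.
      by apply: le_trans dge; rewrite le_eqVlt; apply/orP; left; apply/eqP; rewrite /C1; field.
    apply: lt_le_trans dge; move: C1w; rewrite /C1; set e := expR _ => h.
    by have -> : (1 - e) * (w ^+ 2 / 2) = (1 - e) / 2 * w ^+ 2 by field.
  rewrite invfM mulrCA ler_wpM2l ?invr_ge0 ?(ltW C1_gt0)//.
  have -> : 1 - x = w + 2 * dl by rewrite /w /excess; ring.
  apply: step_fun_dom => //; apply: le_trans J1; exact: w1.
have mstep : measurable_fun setT (step_fun J).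
  apply: measurable_funD.
    by apply: measurable_sum => j; apply: measurable_funM => //; apply: measurable_indic; exact: measurable_ge.
  by apply: measurable_funM => //; apply: measurable_indic; exact: measurable_ge.
apply: (@le_trans _ _ (\int[Gam]_x (C1^-1%:E * (step_fun J x)%:E))%E).
  apply: ge0_le_integral => //.
  - by move=> x _; rewrite lee_fin; exact: bad_weight_ge0.
  - by apply/measurable_EFinP; exact: measurable_bad_weight.
  - by apply/measurable_EFinP; apply: measurable_funM.
  - by move=> x _; rewrite -EFinM lee_fin.
rewrite ge0_integralZl_EFin//; last 3 first.
- by move=> x _; rewrite lee_fin.
- exact/measurable_EFinP.
- by rewrite invr_ge0 ltW.
rewrite -/C1 [C0 / C1]mulrC -mulrA EFinM; apply: lee_wpmul2l.
  by rewrite lee_fin invr_ge0 ltW.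
(* 13 + J <= 14 + 3 * ln (1 / dl), which leaves one unit to spare in the constant 15. *)
apply: le_trans (integral_step_fun J) _; rewrite lee_fin ler_wpM2l//.
  exact: le_trans one_regular_C0_ge1.
lra.
Qed.

End bad_weight_integral.

(** * Law of the bandit restricted to the selected arms *)

Section subsampled_law.
Context (R : realType) (Gam : probability R R) (Pk : R -> probability R R).
Context (k m T : nat) d (Om : measurableType d) (P : probability Om R).
Context (mu : nat -> Om -> R) (Y : nat -> nat -> Om -> R) (sel : nat -> Om -> nat).
Hypothesis law : ss_bandit_law P Gam Pk k m T mu Y sel.
Hypothesis mk : (m <= k)%N.

Let mu' (j : nat) (w : Om) : R := mu (sel j w) w.
Let Y' (j t : nat) (w : Om) : R := Y (sel j w) t w.
Let inj_sel := {ffun 'I_m -> 'I_k}.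
Let selected (s : inj_sel) : set Om :=
  [set w | injectiveb s /\ forall j : 'I_m, sel j w = s j].
Let extend (s : inj_sel) (j : nat) : nat :=
  if insub j is Some i then s i : nat else 0%N.

Let extendE (s : inj_sel) (j : 'I_m) : extend s j = s j.
Proof. by rewrite /extend valK. Qed.

Let selectedE (s : inj_sel) : injectiveb s ->
  selected s = \big[setI/setT]_(j < m) [set w | sel j w = extend s j].
Proof.
move=> s_inj; rewrite -(bigcap_mkord m (fun j => [set w | sel j w = extend s j])).
apply/seteqP; split => w /=.
  by move=> [_ h] j jm; have := h (Ordinal jm); rewrite -extendE.
by move=> h; split => // j; rewrite -extendE; exact: (h j (ltn_ord j)).
Qed.

Let measurable_selected (s : inj_sel) : measurable (selected s).
Proof.
have [_ [msel _]] := law.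
case: (boolP (injectiveb s)) => s_inj.
  by rewrite selectedE//; apply: bigsetI_measurable => j _; exact: msel.
rewrite (_ : selected s = set0)//; apply/seteqP; split => // w [].
by rewrite (negbTE s_inj).
Qed.

Lemma measurable_mean_select (f : nat -> Om -> R) j :
  (forall i, measurable_fun setT (f i)) ->
  measurable_fun setT (fun w => f (sel j w) w).
Proof.
move=> mf _ B mB; have [_ [msel _]] := law; rewrite setTI.
rewrite (_ : _ @^-1` _ = \bigcup_i ([set w | sel j w = i] `&` (f i @^-1` B))).
  apply: bigcup_measurable => i _; apply: measurableI; first exact: msel.
  by rewrite -[X in measurable X]setTI; exact: mf.
apply/seteqP; split => w /=; first by move=> Bw; exists (sel j w).
by move=> [i _ [/= <-]].
Qed.

(** On the event that the selection is [s], a rectangle of the subsample is a rectangle of the full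
    bandit in which arm [s j] carries the constraints of [j]. Unselected arms are free and
    contribute a factor 1. *)
Let prob_selected_rect A B (s : inj_sel) : (forall i, measurable (A i)) ->
  (forall i t, measurable (B i t)) -> injectiveb s ->
  P (rect_event m T mu' Y' A B `&` selected s) =
  (rect_prob Gam Pk m T A B * ((k - m)`!%:R / k`!%:R)%:E)%E.
Proof.
move=> mA mB s_inj; have [_ [_ lawE]] := law.
have /injectiveP inj_s := s_inj.
(* The injection [s] is inverted by searching for a preimage of [i]. *)
pose As i := if [pick j : 'I_m | s j == i :> nat] is Some j then A j else setT.
pose Bs i := if [pick j : 'I_m | s j == i :> nat] is Some j then B j else fun=> setT.
have pickE (j : 'I_m) : [pick i : 'I_m | s i == s j :> nat] = Some j.
  case: pickP => [i /eqP /val_inj/inj_s -> //|/(_ j)]; by rewrite eqxx.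
have mAs i : measurable (As i) by rewrite /As; case: pickP.
have mBs i t : measurable (Bs i t) by rewrite /Bs; case: pickP.
have -> : rect_event m T mu' Y' A B `&` selected s =
    rect_event k T mu Y As Bs `&` \big[setI/setT]_(j < m) [set w | sel j w = extend s j].
  rewrite -selectedE//; apply/seteqP; split => w [/rect_eventP hw hs]; split => //;
      apply/rect_eventP; have [_ hsel] := hs.
    move=> i ik; rewrite /As /Bs; case: pickP => [j /eqP si|_]; last by [].
    have [hA hB] := hw j (ltn_ord j); rewrite -si -hsel.
    by split.
  move=> j jm; have := hw (s (Ordinal jm)) (ltn_ord _).
  rewrite /As /Bs pickE /mu' /Y' => -[hA hB].
  by rewrite -[j]/(val (Ordinal jm)) hsel.
rewrite lawE//; last 2 first.
- by move=> j jm; rewrite -[j]/(val (Ordinal jm)) extendE.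
- move=> j j' jm j'm; rewrite -[j]/(val (Ordinal jm)) -[j']/(val (Ordinal j'm)).
  by rewrite !extendE => /val_inj/inj_s ->.
congr (_ * _)%E; rewrite /rect_prob.
rewrite (bigID (fun i : 'I_k => i \in [set s j | j in 'I_m]%SET)) /=.
rewrite [X in (_ * X)%E]big1 ?mule1; last first.
  move=> i ni; have noj : [pick j : 'I_m | s j == i :> nat] = None.
    case: pickP => // j /eqP/val_inj sj; move/negP: ni; case.
    by apply/imsetP; exists j.
  rewrite /As /Bs noj.
  transitivity (\int[Gam]_x (cst 1%E x))%E.
    by apply: eq_integral => x _; rewrite big1// => t _; rewrite probability_setT.
  by rewrite integral_cst//= [Gam _]probability_setT mul1e.
rewrite (eq_bigl (fun i => i \in [set s j | j in 'I_m]%SET))//.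
rewrite (big_imset _ (h := s)) /=; last by move=> i j _ _; exact: inj_s.
apply: eq_big => // j _; rewrite /As /Bs pickE //.
Qed.

Let sum_selected (E : set Om) : measurable E ->
  P (E `&` \bigcup_s selected s) = (\sum_s P (E `&` selected s))%E.
Proof.
move=> mE; rewrite setI_bigcupr measure_fin_bigcup//.
- rewrite [in RHS](fsbig_seq _ _ (index_enum_uniq _)).
  rewrite (_ : [set` index_enum _] = setT)//.
  by apply/seteqP; split => // s _; exact: mem_index_enum.
- exact: finite_finset.
- move=> s s' _ _ [w [[_ [s_inj hs]] [_ [_ hs']]]].
  by apply/ffunP => j; apply: val_inj; exact: (etrans (esym (hs j)) (hs' j)).
- by move=> s _; exact: measurableI.
Qed.

(** The conditional value is the same for all k! / (k - m)! injections, so summing over them removes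
    the selection probability. *)
Lemma ss_bandit_law_subsample : bandit_law P Gam Pk m T mu' Y'.
Proof.
have [[mmu [mY lawk]] [msel lawE]] := law.
have mmu' i : measurable_fun setT (mu' i) by exact: measurable_mean_select.
have mY' i t : measurable_fun setT (Y' i t).
  by apply: (measurable_mean_select (f := fun i => Y i t)) => j.
split => //; split => // A B mA mB.
have sumE A0 B0 : (forall i, measurable (A0 i)) -> (forall i t, measurable (B0 i t)) ->
    P (rect_event m T mu' Y' A0 B0 `&` \bigcup_s selected s) = rect_prob Gam Pk m T A0 B0.
  move=> mA0 mB0; rewrite sum_selected; last first.
    apply: bigsetI_measurable => i _; apply: measurableI.
      by rewrite -[X in measurable X]setTI; exact: mmu'.
    apply: bigsetI_measurable => t _.
    by rewrite -[X in measurable X]setTI; exact: mY'.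
  rewrite (bigID (fun s : inj_sel => injectiveb s)) /=.
  rewrite [X in (_ + X)%E]big1 ?adde0; last first.
    move=> s ns; rewrite (_ : selected s = set0) ?setI0 ?measure0//.
    by apply/seteqP; split => // w []; rewrite (negbTE ns).
  rewrite (eq_bigr (fun=> rect_prob Gam Pk m T A0 B0 *
    ((k - m)`!%:R / k`!%:R)%:E)%E); last by move=> s; exact: prob_selected_rect.
  rewrite sumr_const; set n := #|_|.
  transitivity (n%:R%:E * (rect_prob Gam Pk m T A0 B0 * ((k - m)`!%:R / k`!%:R)%:E))%E.
    by rewrite mule_natl.
  rewrite muleCA -EFinM.
  have -> : n = (k ^_ m)%N.
    have := card_inj_ffuns 'I_m 'I_k; rewrite !card_ord => <-.
    by apply: eq_card => s; rewrite !inE.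
  by rewrite mulrA -natrM ffact_fact// mulfV ?mule1// pnatr_eq0 -lt0n fact_gt0.
have mU : measurable (\bigcup_(s : inj_sel) selected s).
  by apply: fin_bigcup_measurable => [|s _]; [exact: finite_finset|exact: measurable_selected].
have mrect A0 B0 : (forall i, measurable (A0 i)) -> (forall i t, measurable (B0 i t)) ->
    measurable (rect_event m T mu' Y' A0 B0).
  move=> mA0 mB0; apply: bigsetI_measurable => i _; apply: measurableI.
    by rewrite -[X in measurable X]setTI; exact: mmu'.
  apply: bigsetI_measurable => t _.
  by rewrite -[X in measurable X]setTI; exact: mY'.
(* The case of full sets shows that the injective selections carry all the mass, so the rest of any
   rectangle is null. *)
have PU : P (\bigcup_s selected s) = 1%E.
  have := sumE (fun=> setT) (fun _ _ => setT) (fun=> measurableT) (fun _ _ => measurableT).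
  rewrite (_ : rect_event _ _ _ _ _ _ = setT); last first.
    by apply/seteqP; split => // w _; apply/rect_eventP.
  rewrite setTI => ->; rewrite /rect_prob big1// => i _.
  transitivity (\int[Gam]_x (cst 1%E x))%E.
    by apply: eq_integral => x _; rewrite big1// => t _; rewrite probability_setT.
  by rewrite integral_cst//= [Gam _]probability_setT mul1e.
have mE := mrect A B mA mB.
rewrite -sumE//; apply: etrans (measureDI P mE mU) _.
rewrite -[RHS]add0e; congr (_ + _)%E.
apply: (subset_measure0 (B := ~` (\bigcup_s selected s))).
- exact: measurableD.
- exact: measurableC.
- by move=> w [].
- by apply: etrans (probability_setC P mU) _; rewrite [X in (1 - X)%E]PU subee.
Qed.

End subsampled_law.

(** * The explicit bound on the Bayesian regret *)

Section greedy_bound.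
Context (R : realType).

(** [f] needs no sign and no integrability: its negative part only lowers the integral. This suits
    the regret, which can be negative on the null set where means leave [0, 1]. *)
Lemma le_integral_ae_ge0 d (X : measurableType d) (P : {measure set X -> \bar R})
    (f g : X -> \bar R) : measurable_fun setT f -> measurable_fun setT g ->
  (forall x, 0 <= g x)%E -> {ae P, forall x, (f x <= g x)%E} ->
  (\int[P]_x f x <= \int[P]_x g x)%E.
Proof.
move=> mf mg g0 fg; rewrite integralE.
apply: (@le_trans _ _ (\int[P]_x f^\+ x)%E).
  by rewrite -[leRHS]sube0 leeB// integral_ge0.
apply: ae_ge0_le_integral => //; first exact: measurable_funepos.
by apply: filterS fg => x fx _; rewrite funeposE ge_max fx g0.
Qed.

Definition greedy_bound (c0 C0 : R) (T k : nat) : R :=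
  1 + 3 * T%:R * (2 * expR 1 * ln T%:R / (k%:R * c0)) `^ (3^-1)
  + C0 * k%:R / ((1 - expR (-1)) / 2)
    * (15 + ln (k%:R * c0 / (2 * expR 1)) - ln (ln T%:R)).

Variables (Gam : probability R R) (Pk : R -> probability R R) (c0 C0 : R).
Hypotheses (Gam01 : Gam [set x | 0 <= x <= 1] = 1%E) (fam : reward_family Pk).
Hypotheses (c0_gt0 : 0 < c0) (reg : one_regular Gam c0 C0).
Variables (T k : nat).
Hypotheses (T2 : (2 <= T)%N) (k0 : (0 < k)%N).
Hypothesis kT : 54 * expR 1 * ln T%:R / c0 <= k%:R.

Let e_gt0 : 0 < expR 1 :> R. Proof. exact: expR_gt0. Qed.

Let lnT_gt0 : 0 < ln T%:R :> R.
Proof. by rewrite ln_gt0// ltr1n. Qed.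

Let x0 : R := 2 * expR 1 * ln T%:R / (k%:R * c0).
Let dl : R := x0 `^ (3^-1).

Let kc0_gt0 : 0 < k%:R * c0.
Proof. by rewrite mulr_gt0// ltr0n. Qed.

Let x0_gt0 : 0 < x0.
Proof. by rewrite divr_gt0// !mulr_gt0. Qed.

Let dl_gt0 : 0 < dl.
Proof. exact: powR_gt0. Qed.

Let dl3 : dl ^+ 3 = x0.
Proof. by rewrite -powR_mulrn ?powR_ge0// -powRrM mulVf ?pnatr_eq0// powRr1// ltW. Qed.

(** The constant 54 = 2 * 3^3 of the hypothesis on [k] is what this inequality needs. *)
Let dl_le : 3 * dl <= 1.
Proof.
have x27 : x0 <= 3^-1 ^+ 3.
  rewrite /x0 ler_pdivrMr//.
  have : 54 * expR 1 * ln T%:R <= k%:R * c0 by rewrite -ler_pdivrMr.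
  lra.
have : dl <= 3^-1.
  by rewrite -(ler_pXn2r (n := 3))// ?nnegrE ?(ltW dl_gt0)// dl3.
lra.
Qed.

Lemma miss_prob_le (p : R) : 0 <= p -> Gam [set x | x < 1 - dl] = p%:E ->
  T%:R * (expR (- (dl ^+ 2 / 2)) + (1 - expR (- (dl ^+ 2 / 2))) * p) ^+ k <= 1.
Proof.
move=> p0 pE; set r := expR _.
have dl1 : dl <= 1 by have := dl_gt0; have := dl_le; lra.
have mset : measurable [set x : R | x < 1 - dl].
  have -> : [set x : R | x < 1 - dl] = `]-oo, 1 - dl[%classic.
    by apply/seteqP; split => x /=; rewrite in_itv.
  exact: measurable_itv.
have pc : p <= 1 - c0 * dl.
  have [low [le _]] := reg (e := dl) ltac:(by rewrite dl_gt0 dl1).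
  have := le_trans low le.
  have -> : [set x : R | 1 - dl <= x] = ~` [set x | x < 1 - dl].
    by apply/seteqP; split => x /=; rewrite leNgt => /negP.
  by rewrite probability_setC// pE -EFinB lee_fin; lra.
pose z := dl ^+ 2 / 2.
have z0 : 0 <= z by rewrite divr_ge0// sqr_ge0.
have z1 : z <= 2^-1 by rewrite /z -[leRHS]mul1r ler_wpM2r// expr_le1// ltW.
have r0 : 0 < r by exact: expR_gt0.
have r1 : r <= 1 by rewrite -[leRHS]expR0 ler_expR oppr_le0.
(* Source of the factor e in the bound: 1 - r >= z / (1 + z), and 1 + z <= 2 <= e. *)
have rz : z / expR 1 <= 1 - r.
  have h : r <= (1 + z)^-1 by exact: expRN_le_inv.
  have e2 : 1 + z <= expR 1 by apply: le_trans (expR_ge1Dx _); lra.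
  have h2 : (expR 1)^-1 <= (1 + z)^-1 by rewrite lef_pV2 ?posrE// ltr_pwDl.
  have : z * (expR 1)^-1 <= z * (1 + z)^-1 by rewrite ler_wpM2l.
  have : z * (1 + z)^-1 = 1 - (1 + z)^-1 by field; rewrite gt_eqF// ltr_pwDl.
  lra.
set q := r + _.
have q0 : 0 <= q by rewrite addr_ge0 ?mulr_ge0 ?subr_ge0// ltW.
have qe : q <= expR (- (ln T%:R / k%:R)).
  apply: le_trans (expR_ge1Dx _).
  (* The identity that dictates the value of [dl ^ 3]. *)
  have -> : ln T%:R / k%:R = z / expR 1 * (c0 * dl).
    have := dl3; rewrite /x0 /z => h.
    have -> : dl ^+ 2 / 2 / expR 1 * (c0 * dl) = dl ^+ 3 * c0 / (2 * expR 1).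
      by field; rewrite gt_eqF.
    rewrite h; field.
    by rewrite !gt_eqF// ltr0n.
  have : z / expR 1 * (c0 * dl) <= (1 - r) * (c0 * dl).
    by rewrite ler_wpM2r// mulr_ge0// ltW.
  have : (1 - r) * p <= (1 - r) * (1 - c0 * dl) by rewrite ler_wpM2l// subr_ge0.
  rewrite /q; lra.
apply: (@le_trans _ _ (T%:R * expR (- (ln T%:R / k%:R)) ^+ k)).
  by rewrite ler_wpM2l//; apply: lerXn2r; rewrite ?nnegrE ?expR_ge0.
rewrite -expRM_natl mulrN mulrC mulrC [k%:R * _]mulrC divfK ?pnatr_eq0 -?lt0n//.
rewrite expRN lnK ?posrE ?ltr0n ?(ltn_trans _ T2)//.
by rewrite mulfV// pnatr_eq0 -lt0n (ltn_trans _ T2).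
Qed.

Lemma greedy_gap_le d (Om : measurableType d) (P : probability Om R)
    (mu : nat -> Om -> R) (Y : nat -> nat -> Om -> R) :
  bandit_law P Gam Pk k T mu Y ->
  (\int[P]_w (\sum_(t < T)
      gap (mu (greedy_action k (fun i s => Y i s w) t) w))%:E <=
   (greedy_bound c0 C0 T k)%:E)%E.
Proof.
move=> law.
have mset : measurable [set x : R | x < 1 - dl].
  have -> : [set x : R | x < 1 - dl] = `]-oo, 1 - dl[%classic.
    by apply/seteqP; split => x /=; rewrite in_itv.
  exact: measurable_itv.
pose p := fine (Gam [set x | x < 1 - dl]).
have pE : Gam [set x | x < 1 - dl] = p%:E by rewrite /p fineK// fin_num_measure.
have p0 : 0 <= p by exact: fine_ge0.
apply: le_trans (integral_gap_le Gam01 fam law k0 dl_gt0 pE) _.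
apply: (@le_trans _ _ ((3 * dl * T%:R + 1)%:E +
  (k%:R * (C0 / ((1 - expR (-1)) / 2) * (15 + 3 * ln (dl^-1))))%:E)%E).
  apply: leeD; first by rewrite lee_fin lerD2l; exact: miss_prob_le.
  by rewrite EFinM lee_wpmul2l//; exact: (integral_bad_weight_le Gam01 reg).
rewrite -EFinD lee_fin /greedy_bound -/x0 -/dl.
have -> : 3 * ln (dl^-1) = ln (k%:R * c0 / (2 * expR 1)) - ln (ln T%:R).
  have b0 : 0 < 2 * expR 1 :> R by rewrite mulr_gt0.
  rewrite lnV ?posrE// /dl ln_powR mulrN mulrA mulfV ?mul1r ?pnatr_eq0//.
  rewrite /x0 ln_div ?posrE ?mulr_gt0 ?ltr0n// (lnM (x := 2 * expR 1)) ?posrE//.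
  by rewrite ln_div ?posrE ?mulr_gt0 ?ltr0n//; ring.
by rewrite le_eqVlt; apply/orP; left; apply/eqP; ring.
Qed.

Lemma measurable_max_mean d (Om : measurableType d) (mu : nat -> Om -> R) n :
  (forall i, measurable_fun setT (mu i)) ->
  measurable_fun setT (fun w => max_mean n (fun i => mu i w)).
Proof.
move=> mmu; rewrite /max_mean; elim: (index_enum _) => [|i s ih].
  rewrite (_ : (fun _ => _) = (fun=> 0))//.
  by apply/funext => w; rewrite big_nil.
rewrite (_ : (fun _ => _) = (fun w => Num.max (mu i w) (\big[Num.max/0]_(j <- s) mu j w))).
  exact: measurable_maxr.
by apply/funext => w; rewrite big_cons.
Qed.

(** The comparator [M] is any quantity almost surely at most 1, since regret is measured against 1.
    SS-Greedy can thus compete with the best of all arms while the bound involves only the sampled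
    ones. *)
Lemma regret_le d (Om : measurableType d) (P : probability Om R)
    (mu : nat -> Om -> R) (Y : nat -> nat -> Om -> R) (M : Om -> R) :
  bandit_law P Gam Pk k T mu Y -> measurable_fun setT M ->
  {ae P, forall w, M w <= 1} ->
  (\int[P]_w (T%:R * M w -
      \sum_(t < T) mu (greedy_action k (fun i s => Y i s w) t) w)%:E <=
   (greedy_bound c0 C0 T k)%:E)%E.
Proof.
move=> law mM M1; apply: le_trans (greedy_gap_le law).
apply: le_integral_ae_ge0.
- apply/measurable_EFinP; apply: measurable_funB; first exact: measurable_funM.
  by apply: measurable_sum => t; apply: (measurable_mean_action law k0 (g := id)) => //; exact: ltnW.
- apply/measurable_EFinP; apply: measurable_sum => t.
  by apply: (measurable_mean_action law k0) => //; [exact: ltnW|exact: measurable_gap].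
- by move=> w; rewrite lee_fin sumr_ge0// => t _; exact: gap_ge0.
apply: filterS2 M1 (ae_means01 Gam01 law) => w M1 m01; rewrite lee_fin.
apply: (@le_trans _ _ (\sum_(t < T) (1 - mu (greedy_action k (fun i s => Y i s w) t) w))).
  by rewrite sumrB lerD2r sumr_const card_ord -[leRHS]mulr_natl ler_wpM2l.
apply: ler_sum => t _; rewrite /gap ifT// m01//.
exact: greedy_action_lt.
Qed.

Lemma ae_max_mean_le1 n d (Om : measurableType d) (P : probability Om R)
    (mu : nat -> Om -> R) (Y : nat -> nat -> Om -> R) :
  bandit_law P Gam Pk n T mu Y ->
  {ae P, forall w, max_mean n (fun i => mu i w) <= 1}.
Proof.
move=> law; apply: filterS (ae_means01 Gam01 law) => w m01.
by apply: bigmax_le => // i _; have /andP[] := m01 i (ltn_ord i).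
Qed.

Lemma greedy_regret_le d (Om : measurableType d) (P : probability Om R)
    (mu : nat -> Om -> R) (Y : nat -> nat -> Om -> R) :
  bandit_law P Gam Pk k T mu Y ->
  (\int[P]_w (greedy_regret k T (fun i => mu i w) (fun i t => Y i t w))%:E <=
   (greedy_bound c0 C0 T k)%:E)%E.
Proof.
move=> law; apply: (regret_le law); last exact: ae_max_mean_le1 law.
by apply: measurable_max_mean; have [] := law.
Qed.

Lemma ssgreedy_regret_le n d (Om : measurableType d) (P : probability Om R)
    (mu : nat -> Om -> R) (Y : nat -> nat -> Om -> R) (sel : nat -> Om -> nat) :
  (k <= n)%N -> ss_bandit_law P Gam Pk n k T mu Y sel ->
  (\int[P]_w (ssgreedy_regret n k T (fun i => mu i w) (fun i t => Y i t w)
      (fun j => sel j w))%:E <= (greedy_bound c0 C0 T k)%:E)%E.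
Proof.
move=> kn sslaw; have [law _] := sslaw.
apply: (regret_le (ss_bandit_law_subsample sslaw kn)); last exact: ae_max_mean_le1 law.
by apply: measurable_max_mean; have [] := law.
Qed.

End greedy_bound.

(** * The rate for a number of arms of order T^(3/4) *)

Section greedy_bound_rate.
Context (R : realType) (c0 C0 c1 c2 : R).
Hypotheses (c0_gt0 : 0 < c0) (C0_gt0 : 0 < C0) (c1_gt0 : 0 < c1) (c2_gt0 : 0 < c2).

Let A : R := 54 * 4 * expR 1 / (c0 * c1).
(** The added 1 ensures K >= 1, so K is at most K^3 and the cube root can be bounded without
    extracting that of the constant. *)
Let K : R := 2 * expR 1 / (c1 * c0) + 1.
Let a : R := ln (c2 * c0 / (2 * expR 1)).
Let C1 : R := (1 - expR (-1)) / 2.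

Lemma greedy_bound_rate (T m : nat) : (3 <= T)%N -> A ^+ 2 <= T%:R ->
  c1 * T%:R `^ (3 / 4) <= m%:R <= c2 * T%:R `^ (3 / 4) ->
  [/\ (0 < m)%N, 54 * expR 1 * ln T%:R / c0 <= m%:R &
    greedy_bound c0 C0 T m <=
      (1 + 3 * K + C0 * c2 / C1 * (16 + `|a|)) * T%:R `^ (3 / 4) * ln T%:R].
Proof.
move=> T3 TA; set X := _ `^ _; set l := ln _ => /andP[m1 m2].
have e0 : 0 < expR 1 :> R by exact: expR_gt0.
have T0 : 0 < T%:R :> R by rewrite ltr0n (leq_trans _ T3).
have T1 : 1 <= T%:R :> R by rewrite ler1n (leq_trans _ T3).
(* In terms of y, m is of order y^3 and both T * (ln T / m)^(1/3) and m * ln T are y^3 up to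
   logarithms. As ln T <= 4 * y, the requirement on [m] reduces to y^2 >= A, which is T >= A^2. *)
pose y : R := T%:R `^ (4^-1).
have y0 : 0 < y by exact: powR_gt0.
have y4 : y ^+ 4 = T%:R.
  by rewrite -powR_mulrn ?ltW// -powRrM mulVf ?pnatr_eq0// powRr1// ltW.
have y3 : y ^+ 3 = X.
  by rewrite -powR_mulrn ?ltW// -powRrM mulrC.
have y1 : 1 <= y.
  by rewrite -(ler_pXn2r (n := 4)) ?nnegrE ?(ltW y0)// expr1n y4.
have lE : l = 4 * ln y by rewrite /l -y4 lnXn// mulr_natl.
(* T >= 3 >= e gives ln T >= 1, which lets all constants be absorbed into multiples of ln T. *)
have l1 : 1 <= l.
  have e3 : expR 1 <= 3 :> R.
    have h := expRN1_ge R; rewrite expRN in h.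
    by rewrite -[leRHS]invrK -[leLHS]invrK lef_pV2 ?posrE ?invr_gt0.
  rewrite -ler_expR /l lnK ?posrE//; apply: le_trans e3 _.
  by rewrite ler_nat.
have ly : l <= 4 * y.
  rewrite lE ler_wpM2l//; apply: ltW; exact: ln_sublinear.
have X0 : 0 < X by rewrite -y3 exprn_gt0.
have X1 : 1 <= X by rewrite -y3 exprn_ege1.
have m0 : 0 < m%:R :> R by apply: lt_le_trans m1; exact: mulr_gt0.
have A0 : 0 < A by rewrite /A divr_gt0// !mulr_gt0.
have yA : A <= y ^+ 2.
  rewrite -(ler_pXn2r (n := 2)) ?nnegrE ?sqr_ge0 ?(ltW A0)//.
  by rewrite -exprM y4.
split; first by rewrite -(ltr0n R).
  apply: le_trans m1; rewrite ler_pdivrMr// -y3.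
  have h : 54 * expR 1 * l <= 54 * 4 * expR 1 * y.
    have : 54 * expR 1 * l <= 54 * expR 1 * (4 * y) by rewrite ler_wpM2l// mulr_ge0// ltW.
    lra.
  apply: le_trans h _.
  have -> : 54 * 4 * expR 1 * y = c0 * c1 * y * A.
    by rewrite /A; field; rewrite !gt_eqF.
  have -> : c1 * y ^+ 3 * c0 = c0 * c1 * y * y ^+ 2 by ring.
  by rewrite ler_wpM2l// ltW// !mulr_gt0.
have C1_gt0 : 0 < C1.
  by rewrite divr_gt0// subr_gt0 -[ltRHS]expR0 ltr_expR oppr_lt0.
have l0 : 0 < l by exact: lt_le_trans l1.
pose K0 : R := 2 * expR 1 / (c1 * c0).
have K0_gt0 : 0 < K0 by rewrite divr_gt0// !mulr_gt0.
have K1 : 1 <= K by rewrite /K lerDr ltW.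
have K_gt0 : 0 < K by exact: lt_le_trans K1.
have second : 3 * T%:R * (2 * expR 1 * l / (m%:R * c0)) `^ (3^-1) <= 3 * K * X * l.
  have h : 2 * expR 1 * l / (m%:R * c0) <= (K * l / y) ^+ 3.
    apply: (@le_trans _ _ (2 * expR 1 * l / (c1 * X * c0))).
      apply: ler_wpM2l; first by apply/ltW; rewrite !mulr_gt0.
      by rewrite lef_pV2 ?posrE ?mulr_gt0// ler_wpM2r// ltW.
    have -> : 2 * expR 1 * l / (c1 * X * c0) = K0 * l / y ^+ 3.
      by rewrite /K0 -y3; field; rewrite !gt_eqF// exprn_gt0.
    rewrite !exprMn exprVn; apply: ler_wpM2r.
      by apply/ltW; rewrite invr_gt0 exprn_gt0.
    apply: (@le_trans _ _ (K * l)); first by rewrite ler_pM2r// /K lerDl.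
    by apply: ler_pM; [exact: ltW|exact: ltW|exact: ler_eXnr|exact: ler_eXnr].
  have Kly : 0 <= K * l / y by apply/ltW; rewrite divr_gt0// mulr_gt0.
  have h' : (2 * expR 1 * l / (m%:R * c0)) `^ (3^-1) <= K * l / y.
    have -> : K * l / y = ((K * l / y) ^+ 3) `^ (3^-1).
      by rewrite -powR_mulrn// -powRrM mulfV ?pnatr_eq0// powRr1.
    apply: ge0_ler_powR => //; rewrite ?nnegrE ?exprn_ge0//.
    by apply/ltW; rewrite divr_gt0// !mulr_gt0.
  apply: (@le_trans _ _ (3 * T%:R * (K * l / y))).
    by rewrite ler_wpM2l// mulr_ge0.
  rewrite -y4 -y3 le_eqVlt; apply/orP; left; apply/eqP.
  by field; rewrite gt_eqF.
have third : C0 * m%:R / C1 * (15 + ln (m%:R * c0 / (2 * expR 1)) - ln l) <=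
    C0 * c2 / C1 * (16 + `|a|) * X * l.
  have lnl : 0 <= ln l by exact: ln_ge0.
  have lnm : ln (m%:R * c0 / (2 * expR 1)) <= `|a| + l.
    apply: (@le_trans _ _ (ln (c2 * c0 / (2 * expR 1) * X))).
      rewrite ler_ln ?posrE ?divr_gt0 ?mulr_gt0// ?divr_gt0 ?mulr_gt0//.
      have -> : c2 * c0 / (2 * expR 1) * X = c2 * X * c0 / (2 * expR 1) by ring.
      by rewrite ler_pM2r ?invr_gt0 ?mulr_gt0// ler_pM2r.
    rewrite lnM ?posrE ?divr_gt0 ?mulr_gt0// -/a lerD ?ler_norm//.
    rewrite /X ln_powR -/l; lra.
  have F : 15 + ln (m%:R * c0 / (2 * expR 1)) - ln l <= (16 + `|a|) * l.
    have : `|a| <= `|a| * l by rewrite ler_peMr.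
    lra.
  apply: (@le_trans _ _ (C0 * m%:R / C1 * ((16 + `|a|) * l))).
    by rewrite ler_pM2l// divr_gt0// mulr_gt0.
  have -> : C0 * c2 / C1 * (16 + `|a|) * X * l =
    C0 / C1 * ((16 + `|a|) * l) * (c2 * X) by ring.
  have -> : C0 * m%:R / C1 * ((16 + `|a|) * l) =
    C0 / C1 * ((16 + `|a|) * l) * m%:R by ring.
  by rewrite ler_pM2l// mulr_gt0 ?divr_gt0// mulr_gt0// ltr_wpDr.
have first : 1 <= X * l by rewrite mulr_ege1.
rewrite /greedy_bound -/C1 -/l; lra.
Qed.

End greedy_bound_rate.

Unset Implicit Arguments.

Theorem theorem6 (R : realType) (Gam : probability R R)
  (Pk : R -> probability R R) (c0 C0 : R) :
  prior_on_01_with_density Gam ->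
  0 < c0 -> c0 < C0 -> one_regular Gam c0 C0 ->
  reward_family Pk ->
  (* Part 1: explicit bound for Greedy *)
  (forall T k : nat, (2 <= T)%N -> (0 < k)%N ->
     54 * expR 1 * ln T%:R / c0 <= k%:R ->
     forall (d : measure_display) (Om : measurableType d) (P : probability Om R)
       (mu : nat -> Om -> R) (Y : nat -> nat -> Om -> R),
     bandit_law P Gam Pk k T mu Y ->
     (\int[P]_w (greedy_regret k T (fun i => mu i w) (fun i t => Y i t w))%:E
      <= (1 + 3 * T%:R * (2 * expR 1 * ln T%:R / (k%:R * c0)) `^ (3^-1)
          + C0 * k%:R / ((1 - expR (-1)) / 2)
            * (15 + ln (k%:R * c0 / (2 * expR 1)) - ln (ln T%:R)))%:E)%E)
  /\
  (* Part 2: SS-Greedy with m = Theta(T^(3/4)) has regret O~(T^(3/4)) *)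
  (forall (msel : nat -> nat) (c1 c2 : R) (T1 : nat), 0 < c1 -> 0 < c2 ->
     (forall T : nat, (T1 <= T)%N ->
        c1 * T%:R `^ (3 / 4) <= (msel T)%:R <= c2 * T%:R `^ (3 / 4)) ->
     exists (C : R) (p T0 : nat), forall T k : nat, (T0 <= T)%N -> (msel T <= k)%N ->
       forall (d : measure_display) (Om : measurableType d) (P : probability Om R)
         (mu : nat -> Om -> R) (Y : nat -> nat -> Om -> R) (sel : nat -> Om -> nat),
       ss_bandit_law P Gam Pk k (msel T) T mu Y sel ->
       (\int[P]_w (ssgreedy_regret k (msel T) T (fun i => mu i w)
                     (fun i t => Y i t w) (fun j => sel j w))%:E
        <= (C * T%:R `^ (3 / 4) * (ln T%:R) ^+ p)%:E)%E).
Proof.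
move=> [Gam01 _] c0_gt0 c0C0 reg fam; split.
  move=> T k T2 k0 kT d Om P mu Y law.
  exact: (greedy_regret_le Gam01 fam c0_gt0 reg T2 k0 kT law).
move=> msel c1 c2 T1 c1_gt0 c2_gt0 mT.
have C0_gt0 : 0 < C0 by exact: lt_trans c0C0.
pose A : R := (54 * 4 * expR 1 / (c0 * c1)) ^+ 2.
have A0 : 0 <= A by exact: sqr_ge0.
pose C : R := 1 + 3 * (2 * expR 1 / (c1 * c0) + 1) +
  C0 * c2 / ((1 - expR (-1)) / 2) * (16 + `|ln (c2 * c0 / (2 * expR 1))|).
(* One logarithm suffices. The threshold makes ln T >= 1, makes the bounds on [msel] available, and
   makes T at least the squared constant [A]. *)
exists C, 1%N, (maxn 3 (maxn T1 (Num.truncn A).+1)) => T k.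
rewrite !geq_max => /and3P[T3 TT1 TA] mk d Om P mu Y sel law.
have TA' : A <= T%:R.
  have /andP[_ AT] := truncn_itv A0.
  by apply: le_trans (ltW AT) _; rewrite ler_nat.
have [m0 mln rate] := greedy_bound_rate c0_gt0 C0_gt0 c1_gt0 c2_gt0 T3 TA' (mT T TT1).
apply: le_trans (ssgreedy_regret_le Gam01 fam c0_gt0 reg (ltnW T3) m0 mln mk law) _.
by rewrite lee_fin expr1.
Qed.
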